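(* For every mutually completely dependent copula $A_h$ the length measure $\ell$ and Kendall's $\tau$ satisfy $$\ell(A_h)= 1 - \frac{2-\sqrt{2}}{4}\,\bigl(1-\tau(A_h)\bigr).$$
   Context: $\lambda$ and $\lambda_2$ denote Lebesgue measure on the Borel sets of $[0,1]$ and $[0,1]^2$. For a bivariate copula $A$, $\mu_A$ denotes the corresponding doubly stochastic probability measure on $[0,1]^2$, i.e. $\mu_A([0,x]\times[0,y])=A(x,y)$ for all $x,y\in[0,1]$. Mutually completely dependent copulas: for a (Borel measurable) transformation $h:[0,1]\to[0,1]$ that is $\lambda$-preserving (i.e. $\lambda(h^{-1}(E))=\lambda(E)$ for every Borel set $E\subseteq[0,1]$), the completely dependent copula $A_h$ is the copula for which $K(x,E)=\mathbf 1_E(h(x))$ is a version of the regular conditional distribution of $Y$ given $X=x$ when $(X,Y)\sim A_h$; equivalently $A_h(x,y)=\lambda\{t\in[0,x]: h(t)\le y\}$. $A_h$ is called mutually completely dependent if $h$ is moreover bijective. Kendall's tau of a copula $A$ is $\tau(A)=4\int_{[0,1]^2}A\,d\mu_A-1$. Length measure: for a copula $A$ and $t\in[0,1]$ let $[A]_t=\{(x,y)\in[0,1]^2: A(x,y)\ge t\}$, let $\Gamma_{A,t}$ be the boundary of $[A]_t$ in $(0,1)^2$, and let $L_A(t)=H_1(\Gamma_{A,t})$ be its arc-length ($H_1$ is one-dimensional Hausdorff measure). The length measure of $A$ is $\ell(A)=\int_{(0,1)}L_A(t)\,d\lambda(t)$. *)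

(* Defs.v *)
From HB Require Import structures.
From mathcomp Require Import all_boot all_order all_algebra.
From mathcomp Require Import all_classical all_reals all_analysis.

Set Implicit Arguments.
Unset Strict Implicit.
Unset Printing Implicit Defensive.

Import Order.TTheory GRing.Theory Num.Theory.
Import numFieldNormedType.Exports.

Local Open Scope classical_set_scope.
Local Open Scope ring_scope.

(* Transformations of [0,1] and copulas are represented by total functions on
   R and R * R; only their values on [0,1], resp. [0,1]^2, are ever used. *)

Definition unit_interval (R : realType) : set R := `[0, 1]%classic.
Arguments unit_interval R : clear implicits.

Definition unit_square (R : realType) : set (R * R) :=
  unit_interval R `*` unit_interval R.
Arguments unit_square R : clear implicits.

Definition open_unit_square (R : realType) : set (R * R) :=
  `]0, 1[%classic `*` `]0, 1[%classic.
Arguments open_unit_square R : clear implicits.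

Definition lambda_preserving (R : realType) (h : R -> R) : Prop :=
  [/\ measurable_fun (unit_interval R) h,
      set_fun (unit_interval R) (unit_interval R) h &
      forall E : set R, measurable E -> E `<=` unit_interval R ->
        lebesgue_measure (unit_interval R `&` h @^-1` E) = lebesgue_measure E].

Definition completely_dependent_copula (R : realType) (h : R -> R) :
    R * R -> R :=
  fun p => fine (lebesgue_measure
                   [set t | t \in `[0, p.1]%R /\ h t <= p.2]).

Definition is_copula_measure (R : realType) (A : R * R -> R)
    (mu : probability (R * R)%type R) : Prop :=
  forall x y : R, x \in `[0, 1]%R -> y \in `[0, 1]%R ->
    mu (`[0, x]%classic `*` `[0, y]%classic) = (A (x, y))%:E.

(* The measure [mu_A]: a copula [A] determines it uniquely, among all Borel
   probabilities on the plane, since it gives mass [A (1, 1) = 1] to [0,1]^2.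
   The Dirac mass is a default for functions [A] which are not copulas. *)
Definition copula_measure (R : realType) (A : R * R -> R) :
    probability (R * R)%type R :=
  xget (dirac ((0, 0) : R * R) : probability (R * R)%type R)
    (is_copula_measure A).

Definition kendall_tau (R : realType) (A : R * R -> R) : R :=
  4 * (\int[copula_measure A]_(p in unit_square R) A p) - 1.

(* The library's norm on [R * R] is the sup norm, hence the explicit Euclidean
   distance. *)
Definition euclidean_dist (R : realType) (p q : R * R) : R :=
  Num.sqrt ((p.1 - q.1) ^+ 2 + (p.2 - q.2) ^+ 2).

(* The element 0 only matters for the empty set: [ereal_sup set0 = -oo]. *)
Definition diameter (R : realType) (U : set (R * R)) : \bar R :=
  ereal_sup (0%E |` [set (euclidean_dist p q)%:E | p in U & q in U]).

Definition hausdorff1_delta (R : realType) (delta : R) (S : set (R * R)) :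
    \bar R :=
  ereal_inf [set (\sum_(0 <= i <oo) diameter (U i))%E | U in
    [set U : nat -> set (R * R) |
      S `<=` \bigcup_i U i /\ forall i, (diameter (U i) <= delta%:E)%E]].

Definition hausdorff1 (R : realType) (S : set (R * R)) : \bar R :=
  ereal_sup [set hausdorff1_delta delta S | delta in [set d : R | 0 < d]].

Definition upper_level_set (R : realType) (A : R * R -> R) (t : R) :
    set (R * R) :=
  [set p | unit_square R p /\ t <= A p].

Definition level_boundary (R : realType) (A : R * R -> R) (t : R) :
    set (R * R) :=
  open_unit_square R `&`
    (closure (upper_level_set A t) `\` interior (upper_level_set A t)).

Definition level_length (R : realType) (A : R * R -> R) (t : R) : \bar R :=
  hausdorff1 (level_boundary A t).

Definition length_measure (R : realType) (A : R * R -> R) : \bar R :=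
  (\int[lebesgue_measure]_(t in `]0%R, 1%R[) level_length A t)%E.

(* Main.v *)
(* Write [F] for the copula. Its gradient takes its values in [{0, 1}^2]: [F] increases with [x] at
   (x, y) where [h x <= y], and with [y] where [h^-1 y <= x]. Hence level curves
   are horizontal, vertical or of slope -1, and by the coarea formula the length
   measure is the integral of the norm of the gradient, namely
   [1/2 + 1/2 - (2 - sqrt 2) P] where [P] is the area of the set where both
   partial derivatives are 1. In the coordinates (x, s) with [y = h s], [P] is
   the area of [{s <= x, h x <= h s}], the inversions of [h], and
   [tau = 1 - 4 P].

   The two halves of the coarea formula are proved directly. Upper bound: the
   level curve is antitone; between consecutive points cut out by diagonals its
   chord [(dx, dy)] is at most [dx + dy - (2 - sqrt 2) m], where [m] is the mass
   of the points below the curve with abscissa in the step. Lower bound: an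
   antitone set of diameter [d] has [a * dx + b * dy <= d] whenever
   [a ^ 2 + b ^ 2 <= 1], so the length is at least a weighted sum of the
   projections of the curve inside finitely many separated boxes. By Lusin's
   theorem the gradient is constant on most of each box of a fine grid, and the
   weights are chosen accordingly. *)

Require Import Defs.
From HB Require Import structures.
From mathcomp Require Import all_boot all_order all_algebra.
From mathcomp Require Import all_classical all_reals all_analysis.
From mathcomp Require Import measurable_realfun.
From mathcomp Require Import ring lra.

Set Implicit Arguments.
Unset Strict Implicit.
Unset Printing Implicit Defensive.

Import Order.TTheory GRing.Theory Num.Theory.
Import numFieldNormedType.Exports.

Local Open Scope classical_set_scope.
Local Open Scope ring_scope.

(** * The copula as a distribution function *)

(** The inverse of [h] is never formed. Ordinates are written as [h s], which costs nothing because
    [h] preserves measure, and increments of [F] become measures of preimages under [h]. Injectivity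
    serves twice: ties [h x = h s] occur only for [x = s], so weak and strict inversions have the
    same area, and the inverse of [h] is uniformly continuous on a compact set where [h] is
    continuous. Measurability in [t] of the length of the level curve is not established. Each half
    therefore compares the length, level by level, with an explicit function of [t] made of measures
    of sections; Tonelli then evaluates the integral of that function. For this the weights of the
    lower bound may depend on the box but not on [t]. They are nearly optimal because the truth
    values of [s <= x] and [h x <= h s] are constant on most of a small box: within it [x], [s],
    [h x] and [h s] all vary little, and the points close to a tie have small area. *)

Lemma lebesgue_fin_num (R : realType) (a b : R) (S : set R) :
  measurable S -> S `<=` `[a, b] -> lebesgue_measure S \is a fin_num.
Proof.
move=> mS Sab; rewrite ge0_fin_numE//.
apply: le_lt_trans (_ : (lebesgue_measure `[a, b]%classic < +oo)%E).
  by apply: le_measure => //; rewrite inE.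
by rewrite lebesgue_measure_itv; case: ifP => //; rewrite -EFinB ltry.
Qed.

Lemma lebesgue_itv (R : realType) (b1 b2 : bool) (x y : R) : x <= y ->
  lebesgue_measure [set` Interval (BSide b1 x) (BSide b2 y)] = (y - x)%:E.
Proof.
move=> xy; rewrite lebesgue_measure_itv/= lte_fin.
case: ifPn => [_|]; first by rewrite -EFinB.
rewrite -leNgt => yx; have -> : x = y by apply/eqP; rewrite eq_le xy.
by rewrite subrr.
Qed.

(* A measure-preserving bijection of [0,1], continued by the identity so that it
   is a Borel rearrangement of the whole line. *)
Definition rearrangement (R : realType) (h : R -> R) : Prop :=
  [/\ measurable_fun setT h,
      forall E : set R, measurable E ->
        lebesgue_measure (h @^-1` E) = lebesgue_measure E,
      forall s, 0 <= s <= 1 -> 0 <= h s <= 1,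
      forall s, ~ (0 <= s <= 1) -> h s = s &
      injective h].

Section rearrangement.
Variables (R : realType) (h : R -> R).
Hypothesis hR : rearrangement h.

Let mh : measurable_fun setT h. Proof. by case: hR. Qed.
Let hp (E : set R) : measurable E ->
  lebesgue_measure (h @^-1` E) = lebesgue_measure E.
Proof. by case: hR => _ + _ _ _; exact. Qed.
Let hin s : 0 <= s <= 1 -> 0 <= h s <= 1.
Proof. by case: hR => _ _ + _ _; exact. Qed.
Let hout s : ~ (0 <= s <= 1) -> h s = s.
Proof. by case: hR => _ _ _ + _; exact. Qed.

Local Notation lam := (@lebesgue_measure R).
Local Notation F := (completely_dependent_copula h).

Lemma measurable_preimage_itv (i : interval R) : measurable (h @^-1` [set` i]).
Proof. by rewrite -[X in measurable X]setTI; apply: mh. Qed.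

Lemma rearrangement_ge0 s : 0 <= s -> 0 <= h s.
Proof.
move=> s0; have [s1|s1] := leP s 1.
  by have /andP[] := hin (introT andP (conj s0 s1)).
by rewrite hout//; apply/negP; rewrite negb_and -!ltNge s1 orbT.
Qed.

Lemma rearrangement_le1 s : s <= 1 -> h s <= 1.
Proof.
move=> s0; have [s1|s1] := leP 0 s.
  by have /andP[] := hin (introT andP (conj s1 s0)).
by rewrite hout//; apply/negP; rewrite negb_and -!ltNge s1.
Qed.

Lemma rearrangement_gt1 s : 1 < s -> h s = s.
Proof. by move=> s1; rewrite hout//; apply/negP; rewrite negb_and -!ltNge s1 orbT. Qed.

Definition cdf_set (x y : R) : set R := `[0, x] `&` h @^-1` `]-oo, y].

Lemma measurable_cdf_set x y : measurable (cdf_set x y).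
Proof. by apply: measurableI => //; exact: measurable_preimage_itv. Qed.

Lemma cdf_setE x y : (F (x, y))%:E = lam (cdf_set x y).
Proof.
rewrite /completely_dependent_copula fineK/=; last first.
  rewrite [X in lam X](_ : _ = cdf_set x y); last first.
    by apply/seteqP; split => s /=; rewrite /cdf_set/= ?in_itv.
  by apply: (@lebesgue_fin_num _ 0 x); [exact: measurable_cdf_set|move=> s []].
by congr lam; apply/seteqP; split => s /=; rewrite /cdf_set/= ?in_itv.
Qed.

Lemma cdf_incrl x x' y : 0 <= x -> x <= x' ->
  (F (x', y) - F (x, y))%:E = lam (`]x, x'] `&` h @^-1` `]-oo, y]).
Proof.
move=> x0 xx'; rewrite EFinB !cdf_setE.
have -> : cdf_set x' y =
    cdf_set x y `|` (`]x, x'] `&` h @^-1` `]-oo, y]).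
  rewrite /cdf_set -setIUl; congr (_ `&` _); apply/seteqP; split => s /=;
    rewrite !in_itv/=; lra.
rewrite measureU//=; [|exact: measurable_cdf_set|..].
- rewrite [(lam (cdf_set x y) + _)%R]addrC; rewrite [LHS]addeK//; apply: (@lebesgue_fin_num _ 0 x).
    exact: measurable_cdf_set.
  by move=> s [].
- by apply: measurableI => //; exact: measurable_preimage_itv.
- by apply/seteqP; split => s //=; rewrite /cdf_set/= !in_itv/=; lra.
Qed.

Lemma cdf_incrr x y y' : y <= y' ->
  (F (x, y') - F (x, y))%:E = lam (`[0, x] `&` h @^-1` `]y, y']).
Proof.
move=> yy'; rewrite EFinB !cdf_setE.
have -> : cdf_set x y' =
    cdf_set x y `|` (`[0, x] `&` h @^-1` `]y, y']).
  rewrite /cdf_set -setIUr; congr (_ `&` _); apply/seteqP; split => s /=;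
    rewrite !in_itv/=; lra.
rewrite measureU//=; [|exact: measurable_cdf_set|..].
- rewrite [(lam (cdf_set x y) + _)%R]addrC; rewrite [LHS]addeK//; apply: (@lebesgue_fin_num _ 0 x).
    exact: measurable_cdf_set.
  by move=> s [].
- by apply: measurableI => //; exact: measurable_preimage_itv.
- by apply/seteqP; split => s //=; rewrite /cdf_set/= !in_itv/=; lra.
Qed.

Lemma cdf_eq0 x y : x <= 0 -> F (x, y) = 0.
Proof.
move=> x0; apply: EFin_inj; rewrite cdf_setE; apply/eqP; rewrite eq_le measure_ge0 andbT.
rewrite -[leRHS](lebesgue_measure_set1 (0 : R)); apply: le_measure; rewrite ?inE//.
  exact: measurable_cdf_set.
by move=> s; rewrite /cdf_set/= in_itv/=; lra.
Qed.

Lemma cdf_ge0 x y : 0 <= F (x, y).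
Proof. by rewrite -lee_fin cdf_setE. Qed.

Lemma cdf_incrl_bounds x x' y : x <= x' -> 0 <= F (x', y) - F (x, y) <= x' - x.
Proof.
(* [F] vanishes for abscissae up to 0, so a negative [x] may be replaced by 0, where [cdf_incrl]
   applies. *)
move=> xx'; wlog x0 : x xx' / 0 <= x.
  move=> H; have [/H|x0] := leP 0 x; first exact.
  have [x'0|x'0] := leP x' 0; first by rewrite !cdf_eq0; lra.
  have := H 0 (ltW x'0) (lexx 0).
  by rewrite (cdf_eq0 _ (ltW x0)) (@cdf_eq0 0 y)//; lra.
rewrite -!lee_fin cdf_incrl// measure_ge0/=.
rewrite -(@lebesgue_itv _ false false x x')//; apply: le_measure; rewrite ?inE//.
by apply: measurableI => //; exact: measurable_preimage_itv.
Qed.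

(** The increment is part of the mass of the strip []y, y']], and measure preservation gives that
    strip the mass [y' - y]. *)
Lemma cdf_incrr_bounds x y y' : y <= y' -> 0 <= F (x, y') - F (x, y) <= y' - y.
Proof.
move=> yy'; rewrite -!lee_fin cdf_incrr// measure_ge0/=.
rewrite -(@lebesgue_itv _ false false y y')// -[leRHS]hp//; apply: le_measure; rewrite ?inE//.
- by apply: measurableI => //; exact: measurable_preimage_itv.
- exact: measurable_preimage_itv.
Qed.

Lemma cdf_le x y x' y' : x <= x' -> y <= y' -> F (x, y) <= F (x', y').
Proof.
move=> xx' yy'; have /andP[+ _] := cdf_incrl_bounds y xx'.
by have /andP[+ _] := cdf_incrr_bounds x' yy'; lra.
Qed.

Lemma cdf_lipschitz x y x' y' : x <= x' -> y <= y' ->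
  F (x', y') <= F (x, y) + (x' - x) + (y' - y).
Proof.
move=> xx' yy'; have /andP[_ +] := cdf_incrl_bounds y xx'.
by have /andP[_ +] := cdf_incrr_bounds x' yy'; lra.
Qed.

Lemma cdf_le_fst x y : 0 <= x -> F (x, y) <= x.
Proof. by move=> x0; have := cdf_incrl_bounds y x0; rewrite (@cdf_eq0 0)//; lra. Qed.

Lemma cdf_le_snd x y : 0 <= y -> F (x, y) <= y.
Proof.
move=> y0; have := cdf_incrr_bounds x y0; suff -> : F (x, 0) = 0 by lra.
apply: EFin_inj; rewrite cdf_setE; apply/eqP; rewrite eq_le measure_ge0 andbT.
rewrite -[leRHS](lebesgue_measure_set1 (0 : R)) -[leRHS](hp (measurable_set1 0)).
apply: le_measure; rewrite ?inE//; first exact: measurable_cdf_set.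
  by rewrite -[X in measurable X]setTI; apply: mh.
move=> s; rewrite /cdf_set/= !in_itv/= => -[/andP[s0 _]].
by have := rearrangement_ge0 s0; lra.
Qed.

Lemma cdf_lt0 x y : y < 0 -> F (x, y) = 0.
Proof.
move=> y0; have := @cdf_le x y x 0 (lexx _) (ltW y0); have := cdf_le_snd x (lexx 0).
by have := cdf_ge0 x y; lra.
Qed.

Lemma cdf_x1 x : 0 <= x <= 1 -> F (x, 1) = x.
Proof.
move=> /andP[x0 x1]; apply: EFin_inj; rewrite cdf_setE.
rewrite -[in RHS](subr0 x) -(@lebesgue_itv _ true false 0 x)//; congr lam.
apply/seteqP; split => s; rewrite /cdf_set/= !in_itv/=; first by case.
by move=> /andP[s0 sx]; rewrite s0 sx rearrangement_le1//; lra.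
Qed.

Lemma cdf_1y y : 0 <= y <= 1 -> F (1, y) = y.
Proof.
move=> /andP[y0 y1]; apply: EFin_inj; rewrite cdf_setE.
rewrite -[in RHS](subr0 y) -(@lebesgue_itv _ true false 0 y)// -[RHS]hp//.
have [y1'|y1'] := ltP y 1; last first.
  have -> : y = 1 by lra.
  congr lam; apply/seteqP; split => s; rewrite /cdf_set/= !in_itv/=.
    by move=> [/andP[s0 s1] _]; rewrite rearrangement_ge0// rearrangement_le1.
  move=> hs01; have [s1|s1] := leP 0 s; last first.
    by move: hs01; rewrite hout; lra.
  by have [|s1'] := leP s 1; [|move: hs01; rewrite rearrangement_gt1//]; lra.
congr lam; apply/seteqP; split => s; rewrite /cdf_set/= !in_itv/=.
  by move=> [/andP[s0 s1] ->]; rewrite rearrangement_ge0.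
move=> /andP[hs0 hsy]; split => //; apply/andP; split.
  by rewrite leNgt; apply/negP => s0; move: hs0; rewrite hout; lra.
by rewrite leNgt; apply/negP => s0; move: hsy; rewrite rearrangement_gt1//; lra.
Qed.

End rearrangement.

(** [F] is the measure of the section at [(x, y)] of a measurable set [G] of triples, and such
    section measures are measurable. *)
Lemma measurable_cdf (R : realType) (h : R -> R) : rearrangement h ->
  measurable_fun setT (completely_dependent_copula h).
Proof.
move=> hR; have [mh _ _ _ _] := hR.
pose G : set ((R * R) * R) :=
  [set q | 0 <= q.2] `&` [set q | q.2 <= q.1.1] `&` [set q | h q.2 <= q.1.2].
have mG : measurable G.
  have m2 : measurable_fun [set: (R * R) * R] snd by exact: measurable_snd.
  have m11 : measurable_fun [set: (R * R) * R] (fst \o fst).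
    by apply: measurableT_comp => //; exact: measurable_fst.
  have m12 : measurable_fun [set: (R * R) * R] (snd \o fst).
    by apply: measurableT_comp => //; exact: measurable_snd.
  have mh2 : measurable_fun [set: (R * R) * R] (h \o snd).
    by apply: measurableT_comp.
  apply: measurableI; first apply: measurableI.
  - by rewrite -[X in measurable X]setTI; apply: measurable_fun_le => //; exact: measurable_cst.
  - by rewrite -[X in measurable X]setTI; apply: measurable_fun_le.
  - by rewrite -[X in measurable X]setTI; apply: measurable_fun_le.
apply/measurable_EFinP.
have -> : EFin \o completely_dependent_copula h =
    (@lebesgue_measure R) \o xsection G.
  apply/funext => -[x y] /=; rewrite cdf_setE//; congr lebesgue_measure.
  apply/seteqP; split => s; rewrite /cdf_set xsectionE /G/= !in_itv/=.
    by move=> [/andP[-> ->] ->].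
  by move=> [[-> ->] ->].
exact: measurable_fun_xsection.
Qed.

(** * Level sets as staircases *)

(** Intermediate value theorem with the least solution: [w] is the infimum of the superlevel set,
    and the Lipschitz bound excludes a jump there. Leastness provides the strict inequality required
    in [staircase]. *)
Lemma first_crossing (R : realType) (g : R -> R) (K t a b : R) : 0 < K ->
  {homo g : x y / x <= y} ->
  (forall x y, x <= y -> g y <= g x + K * (y - x)) ->
  g a < t -> t <= g b ->
  exists w, [/\ a < w, w <= b, g w = t & forall w', w' < w -> g w' < t].
Proof.
move=> K0 gle glip gat tgb; pose S := [set w | t <= g w].
have Sa : lbound S a.
  by move=> w; rewrite /S/= => tw; rewrite leNgt; apply/negP => /ltW/gle; lra.
have Si : has_inf S by split; [exists b|exists a].
have lw w' : w' < inf S -> g w' < t.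
  move=> w'w; rewrite ltNge; apply/negP => tw'.
  by have := ge_inf (ex_intro _ a Sa) (tw' : S w'); lra.
have gw : t <= g (inf S).
  rewrite leNgt; apply/negP => gwt.
  have e0 : 0 < (t - g (inf S)) / K by rewrite divr_gt0// subr_gt0.
  have [w tw ww] := inf_adherent e0 Si.
  have w0 := ge_inf (ex_intro _ a Sa) tw.
  have := glip _ _ w0; rewrite /S/= in tw.
  have : K * (w - inf S) < t - g (inf S).
    by rewrite mulrC -ltr_pdivlMr//; lra.
  by lra.
exists (inf S); split => //.
- by rewrite ltNge; apply/negP => /gle; lra.
- by apply: ge_inf => //; exists a.
- apply/eqP; rewrite eq_le gw andbT leNgt; apply/negP => tw.
  have e0 : 0 < (g (inf S) - t) / K by rewrite divr_gt0// subr_gt0.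
  have H : inf S - (g (inf S) - t) / K < inf S by lra.
  have := lw _ H; have := glip _ _ (ltW H).
  have -> : K * (inf S - (inf S - (g (inf S) - t) / K)) = g (inf S) - t.
    by field; rewrite gt_eqF.
  by lra.
Qed.

Section staircase.
Variables (R : realType) (F : R * R -> R).
Hypothesis F_le : forall x y x' y', x <= x' -> y <= y' -> F (x, y) <= F (x', y').
Hypothesis F_lipschitz : forall x y x' y', x <= x' -> y <= y' ->
  F (x', y') <= F (x, y) + (x' - x) + (y' - y).

(** The south-west edge of the superlevel set. The level set [F = t] itself would not do, since it
    may have interior points. The edge is taken in the whole plane, so it contains the end points
    [(t, 1)] and [(1, t)]. *)
Definition staircase (t : R) : set (R * R) :=
  [set p | t <= F p /\ forall x y, x < p.1 -> y < p.2 -> F (x, y) < t].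

Lemma staircase_antitone t p q : staircase t p -> staircase t q ->
  p.1 < q.1 -> q.2 <= p.2.
Proof.
case: p => x y [tp _] [_ /= tq] /= xq; rewrite leNgt; apply/negP => /= yq.
by have := tq _ _ xq yq; lra.
Qed.

(** The difference [p.1 - p.2] parametrises the curve: as it grows, the point moves right and
    down. *)
Lemma staircase_diagonal t p q : staircase t p -> staircase t q ->
  p.1 - p.2 <= q.1 - q.2 -> p.1 <= q.1 /\ q.2 <= p.2.
Proof.
move=> Sp Sq pq; have [pq1|qp1] := leP p.1 q.1; last first.
  by have := staircase_antitone Sq Sp qp1; lra.
by split => //; rewrite leNgt; apply/negP => pq2; have := staircase_antitone Sp Sq; lra.
Qed.

(** [A] is the copula of the given map and [F] that of its extension to the line; the two agree on
    the square only. *)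
Lemma level_boundaryE (A : R * R -> R) (t : R) :
  (forall p, unit_square R p -> A p = F p) ->
  level_boundary A t = staircase t `&` open_unit_square R.
Proof.
move=> AF; rewrite /level_boundary setIC; apply/seteqP; split => -[x y].
  move=> [[clU intU] oxy]; split => //; move: (oxy) => [/= +] +.
  rewrite !in_itv/= => /andP[x0 x1] /andP[y0 y1]; split => /=.
    rewrite leNgt; apply/negP => Ft.
    (* A point within [e] of [(x, y)] has value at most [F (x, y) + 2 * e], and a third of the gap
       keeps this below [t]. *)
    have e0 : 0 < (t - F (x, y)) / 3 by lra.
    have [[x' y'] [[/= sq +] [/=]]] := clU _ (nbhsx_ballx (x, y) _ e0).
    rewrite AF// => tF.
    rewrite /ball/= !ltr_distl => /andP[xe _] /andP[ye _]; move: xe ye.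
    have : 3 * ((t - F (x, y)) / 3) = t - F (x, y) by field.
    move: e0; set e := (t - F (x, y)) / 3 => e0 e3 xe ye.
    have le1 : x <= x + e by lra.
    have le2 : y <= y + e by lra.
    have le3 : x' <= x + e by lra.
    have le4 : y' <= y + e by lra.
    have := F_lipschitz le1 le2; have := F_le le3 le4; lra.
  move=> x' y' xx yy; rewrite ltNge; apply/negP => tF; apply: intU.
  (* The open quadrant north-east of [(x', y')], clipped to the square, is a neighbourhood of
     [(x, y)] inside the level set. *)
  exists (`]Num.max x' 0, 1[%classic, `]Num.max y' 0, 1[%classic) => /=.
    by split; apply: near_in_itvoo; rewrite in_itv/= gt_max ?xx ?yy ?x0 ?y0.
  move=> [a b] [/=]; rewrite !in_itv/= !gt_max => /andP[/andP[xa a0] a1] /andP[/andP[yb b0] b1].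
  have sq : unit_square R (a, b) by split; rewrite /unit_interval/= in_itv/= !ltW.
  by split => //; rewrite AF// (le_trans tF)// F_le// ltW.
move=> [[/= tF Ft] oxy]; split => //; split.
  apply: subset_closure; move: (oxy) => [/= +] +.
  rewrite !in_itv/= => /andP[x0 x1] /andP[y0 y1].
  have sq : unit_square R (x, y) by split; rewrite /unit_interval/= in_itv/= !ltW.
  by split => //=; rewrite AF.
move=> /nbhs_ballP[e /= e0 eU].
have [] : upper_level_set A t (x - e / 2, y - e / 2).
  by apply: eU; split; rewrite /= /ball/= ltr_distl; lra.
by move=> sq; rewrite AF//; have := @Ft (x - e / 2) (y - e / 2); lra.
Qed.

End staircase.

(** * Diameters and Hausdorff premeasures *)

Lemma diameter_ge0 (R : realType) (U : set (R * R)) : (0 <= diameter U)%E.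
Proof. by apply: ereal_sup_ubound; left. Qed.

Lemma euclidean_dist_le_diameter (R : realType) (U : set (R * R)) p q :
  U p -> U q -> ((euclidean_dist p q)%:E <= diameter U)%E.
Proof. by move=> Up Uq; apply: ereal_sup_ubound; right; exists p => //; exists q. Qed.

Lemma diameter_le (R : realType) (U : set (R * R)) (r : R) : 0 <= r ->
  (forall p q, U p -> U q -> euclidean_dist p q <= r) -> (diameter U <= r%:E)%E.
Proof.
move=> r0 H; apply: ge_ereal_sup => _ [->|[p Up [q Uq <-]]]; first by rewrite lee_fin.
by rewrite lee_fin H.
Qed.

Lemma diameter_set0 (R : realType) : diameter (set0 : set (R * R)) = 0%E.
Proof.
by apply/eqP; rewrite eq_le diameter_ge0 andbT; apply: diameter_le.
Qed.

Lemma diameter_box (R : realType) (a b c d : R) : a <= b -> c <= d ->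
  (diameter (`[a, b]%classic `*` `[c, d]%classic) <=
    (Num.sqrt ((b - a) ^+ 2 + (d - c) ^+ 2))%:E)%E.
Proof.
move=> ab cd; apply: diameter_le; first exact: sqrtr_ge0.
move=> [x y] [x' y'] [/= +] + [/= +] +; rewrite !in_itv/= => *.
rewrite /euclidean_dist ler_wsqrtr//= lerD//.
  by rewrite -[leLHS]real_normK ?num_real// lerXn2r ?nnegrE//; [lra|rewrite ler_distl; lra].
by rewrite -[leLHS]real_normK ?num_real// lerXn2r ?nnegrE//; [lra|rewrite ler_distl; lra].
Qed.

Lemma hausdorff1_delta_finite_cover (R : realType) (n : nat) (delta : R)
    (S : set (R * R)) (U : nat -> set (R * R)) (r : nat -> R) :
  (forall p, S p -> exists2 i, (i < n)%N & U i p) ->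
  (forall i, (i < n)%N -> (diameter (U i) <= (r i)%:E)%E) ->
  (forall i, (i < n)%N -> (diameter (U i) <= delta%:E)%E) -> 0 <= delta ->
  (hausdorff1_delta delta S <= (\sum_(i < n) r i)%:E)%E.
Proof.
move=> SU Ur Ud d0.
(* Empty sets complete the finite cover to a sequence; they are free because [diameter set0] is
   0. *)
pose V i := if (i < n)%N then U i else set0.
apply: (@le_trans _ _ (\sum_(0 <= i <oo) diameter (V i))%E).
  apply: ereal_inf_lbound; exists V => //; split.
    by move=> p /SU[i iltn Uip]; exists i => //; rewrite /V iltn.
  move=> i; rewrite /V; case: ifPn => [|_]; first exact: Ud.
  by rewrite diameter_set0 lee_fin.
rewrite (nneseries_split 0 n) => [|i _]; last exact: diameter_ge0.
rewrite [X in (_ + X)%E]eseries0 => [|i ni _]; last first.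
  by rewrite /V ltnNge -[n]add0n ni diameter_set0.
rewrite adde0 add0n big_mkord -sumEFin; apply: lee_sum => i _.
by rewrite /V ltn_ord Ur.
Qed.

Lemma le_hausdorff1_delta (R : realType) (d d' : R) (S : set (R * R)) :
  d <= d' -> (hausdorff1_delta d' S <= hausdorff1_delta d S)%E.
Proof.
move=> dd'; apply: ereal_inf_le_tmp => _ [U [SU Ud] <-].
exists U => //; split => // i.
by rewrite (le_trans (Ud i))// lee_fin.
Qed.

Lemma hausdorff1_delta_ge0 (R : realType) (d : R) (S : set (R * R)) :
  (0 <= hausdorff1_delta d S)%E.
Proof.
apply: le_ereal_inf_tmp => _ [U _ <-].
by apply: nneseries_ge0 => i _ _; exact: diameter_ge0.
Qed.

Lemma hausdorff1_ge0 (R : realType) (S : set (R * R)) : (0 <= hausdorff1 S)%E.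
Proof.
apply: (le_trans (hausdorff1_delta_ge0 1 S)).
by apply: ereal_sup_ubound; exists 1 => //=.
Qed.

(** * Upper bound for the length of a staircase *)

(** The right side is the length of a path with the same end points: a stretch of slope -1 that
    covers [m] in both directions, then axis-parallel pieces [a - m] and [b - m]. The difference of
    the squares is a sum of nonnegative terms. *)
Lemma chord_le (R : realType) (a b m : R) : 0 <= m -> m <= a -> m <= b ->
  Num.sqrt (a ^+ 2 + b ^+ 2) <= a + b - (2 - Num.sqrt 2) * m.
Proof.
move=> m0 ma mb; set q := Num.sqrt 2.
have q2 : q ^+ 2 = 2 by rewrite sqr_sqrtr.
have q1 : 1 <= q by rewrite -[leLHS]sqrtr1 ler_wsqrtr// ler1n.
have -> : a + b - (2 - q) * m = (a - m) + (b - m) + q * m by ring.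
have am : 0 <= a - m by lra.
have bm : 0 <= b - m by lra.
have r0 : 0 <= (a - m) + (b - m) + q * m.
  by apply: addr_ge0; [exact: addr_ge0|apply: mulr_ge0; lra].
rewrite -[leRHS](ger0_norm r0) -sqrtr_sqr ler_wsqrtr// -subr_ge0.
have -> : (a - m + (b - m) + q * m) ^+ 2 - (a ^+ 2 + b ^+ 2) =
    2 * ((a - m) * (b - m)) + 2 * (q - 1) * (m * ((a - m) + (b - m))) +
    (q ^+ 2 - 2) * m ^+ 2 by ring.
rewrite q2 subrr mul0r addr0 addr_ge0// mulr_ge0//; first exact: mulr_ge0.
  by rewrite mulr_ge0// subr_ge0.
by apply: mulr_ge0 => //; exact: addr_ge0.
Qed.

Lemma step_interval (R : realDomainType) (x : nat -> R) (n : nat) (s : R) :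
  x 0%N < s -> s <= x n -> exists2 i, (i < n)%N & x i < s <= x i.+1.
Proof.
move=> x0; elim: n => [|n IH] sx; first by lra.
have [/IH[i ni xi]|xn] := leP s (x n); first by exists i => //; exact: ltnW.
by exists n => //; rewrite xn.
Qed.

Section staircase_length.
Variables (R : realType) (h : R -> R).
Hypothesis hR : rearrangement h.

Local Notation lam := (@lebesgue_measure R).
Local Notation F := (completely_dependent_copula h).

Lemma staircase_ge t p : 0 < t -> staircase F t p -> t <= p.1 /\ t <= p.2.
Proof.
case: p => x y t0 [/= tF _]; split.
  have [x0|x0] := leP x 0; first by rewrite (cdf_eq0 hR _ x0) in tF; lra.
  by have := cdf_le_fst hR y (ltW x0); lra.
have [y0|y0] := ltP y 0; first by rewrite (cdf_lt0 hR _ y0) in tF; lra.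
by have := cdf_le_snd hR x y0; lra.
Qed.

Lemma staircase_meets_diagonal t u : 0 < t <= 1 ->
  exists p, [/\ staircase F t p, p.1 - p.2 = u & F p = t].
Proof.
move=> /andP[t0 t1].
(* Along a diagonal [F] is 2-Lipschitz. It vanishes at [w = 0], and at [1 + |u|] both coordinates
   are at least 1, so [F] is there at least [F (t, 1) = t]. *)
have [|||||w [_ _ Fw wt]] := @first_crossing R (fun w => F (w + u, w)) 2 t 0 (1 + `|u|).
- by [].
- by move=> a b ab; apply: (cdf_le hR) => //; rewrite lerD2r.
- move=> a b ab; have abu : a + u <= b + u by rewrite lerD2r.
  by have := cdf_lipschitz hR abu ab; lra.
- by have := cdf_le_snd hR (0 + u) (lexx 0); lra.
- rewrite -[leLHS](cdf_x1 hR (x := t)); last by rewrite (ltW t0).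
  apply: (cdf_le hR); last by rewrite lerDl.
  by have := ler_norm (- u); rewrite normrN; lra.
exists (w + u, w); split => //=; last by ring.
split => [|x y /= xw yw]; first by rewrite Fw.
(* [(x, y)] is dominated by the point of the diagonal with parameter [max (x - u) y], which comes
   before [w]. *)
apply: le_lt_trans (wt (Num.max (x - u) y) _).
  by apply: (cdf_le hR); [rewrite -lerBlDr|]; rewrite le_max lexx ?orbT.
by rewrite gt_max yw andbT; lra.
Qed.

Lemma staircase_left_corner t : 0 < t <= 1 -> staircase F t (t, 1).
Proof.
move=> /andP[t0 t1]; split => [|x y /= xt _].
  by rewrite (cdf_x1 hR)// t1 ltW.
have [x0|x0] := leP x 0; first by rewrite (cdf_eq0 hR _ x0).
by have := cdf_le_fst hR y (ltW x0); lra.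
Qed.

Lemma staircase_right_corner t : 0 < t <= 1 -> staircase F t (1, t).
Proof.
move=> /andP[t0 t1]; split => [|x y /= _ yt].
  by rewrite (cdf_1y hR)// t1 ltW.
have [y0|y0] := ltP y 0; first by rewrite (cdf_lt0 hR _ y0).
by have := cdf_le_snd hR x y0; lra.
Qed.

Lemma measurable_below_staircase (a b r : R) :
  measurable (`]a, b] `&` [set s | F (s, h s) < r]).
Proof.
have [mh _ _ _ _] := hR.
have -> : [set s | F (s, h s) < r] = (fun s => F (s, h s)) @^-1` `]-oo, r[.
  by apply/seteqP; split => s /=; rewrite in_itv.
apply: measurableI => //; rewrite -[X in measurable X]setTI.
have mF : measurable_fun setT (fun s => F (s, h s)).
  apply: (measurableT_comp (measurable_cdf hR)).
  by apply: measurable_fun_pair.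
by apply: mF.
Qed.

(** The diagonals at distance [d] in the parameter [p.1 - p.2] cut the curve into [n.+1] steps, each
    with [dx + dy = d]. Each step lies in a box whose diagonal is bounded by [chord_le]; the savings
    add up to the mass counted in [lam]. *)
Lemma hausdorff1_delta_staircase t d n : 0 < t < 1 ->
  d = 2 * (1 - t) / n.+1%:R ->
  (hausdorff1_delta d (staircase F t `&` open_unit_square R) +
    (2 - Num.sqrt 2)%:E * lam (`]t, 1%R] `&` [set s | (F (s, h s) < t - d)%R])
    <= (2 * (1 - t))%:E)%E.
Proof.
move=> /andP[t0 t1] dE.
have n0 : 0 < n.+1%:R :> R by rewrite ltr0n.
have d0 : 0 < d by rewrite dE divr_gt0// mulr_gt0//; lra.
have dn : n.+1%:R * d = 2 * (1 - t) by rewrite dE; field; rewrite gt_eqF.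
have t01 : 0 < t <= 1 by rewrite t0 ltW.
pose P u := sval (cid (staircase_meets_diagonal u t01)).
have PS u : staircase F t (P u) by have [] := svalP (cid (staircase_meets_diagonal u t01)).
have Pu u : (P u).1 - (P u).2 = u by have [] := svalP (cid (staircase_meets_diagonal u t01)).
have PF u : F ((P u).1, (P u).2) = t.
  by rewrite -surjective_pairing; have [] := svalP (cid (staircase_meets_diagonal u t01)).
pose u (i : nat) : R := t - 1 + i%:R * d.
have uS i : u i.+1 = u i + d by rewrite /u -natr1; ring.
have u0 : u 0%N = t - 1 by rewrite /u mul0r addr0.
have un : u n.+1 = 1 - t by rewrite /u dn; ring.
pose x i := (P (u i)).1; pose y i := (P (u i)).2.
(* Points of the curve on the same diagonal coincide, so the subdivision starts at [(t, 1)] and ends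
   at [(1, t)]. *)
have P0 : x 0%N = t /\ y 0%N = 1.
  have L := staircase_left_corner t01.
  have [] := staircase_diagonal (PS (u 0%N)) L; first by rewrite Pu u0/=.
  have [] := staircase_diagonal L (PS (u 0%N)); first by rewrite Pu u0/=.
  by rewrite /x /y/=; split; lra.
have Pn : x n.+1 = 1 /\ y n.+1 = t.
  have L := staircase_right_corner t01.
  have [] := staircase_diagonal (PS (u n.+1)) L; first by rewrite Pu un/=.
  have [] := staircase_diagonal L (PS (u n.+1)); first by rewrite Pu un/=.
  by rewrite /x /y/=; split; lra.
have xy i : [/\ x i <= x i.+1, y i.+1 <= y i &
                (x i.+1 - x i) + (y i - y i.+1) = d].
  have [] := staircase_diagonal (PS (u i)) (PS (u i.+1)).
    by rewrite !Pu uS; lra.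
  rewrite -/(x i) -/(x i.+1) -/(y i) -/(y i.+1) => xi yi; split => //.
  have := Pu (u i); have := Pu (u i.+1); rewrite -/(x i) -/(x i.+1) -/(y i) -/(y i.+1) uS.
  by lra.
have xt i : t <= x i by have [] := staircase_ge t0 (PS (u i)).
(* As [F] equals [t] at both ends of the step, [m i] is at once its increment along the lower side
   and along the left side of the box, hence at most [dx] and at most [dy]. *)
pose m i := t - F (x i, y i.+1).
have m_ge0 i : 0 <= m i.
  have [_ yi _] := xy i; have := cdf_le hR (lexx (x i)) yi.
  by rewrite PF /m; lra.
have m_lex i : m i <= x i.+1 - x i.
  have [xi _ _] := xy i; have := cdf_lipschitz hR xi (lexx (y i.+1)).
  by rewrite PF /m; lra.
have m_ley i : m i <= y i - y i.+1.
  have [_ yi _] := xy i; have := cdf_lipschitz hR (lexx (x i)) yi.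
  by rewrite PF /m; lra.
have q2 : Num.sqrt 2 <= 2 :> R.
  rewrite -[leRHS]ger0_norm// -sqrtr_sqr ler_wsqrtr//; lra.
pose r i := d - (2 - Num.sqrt 2) * m i.
have rd i : r i <= d.
  by rewrite /r gerBl// mulr_ge0//; lra.
pose U i : set (R * R) := `[x i, x i.+1]%classic `*` `[y i.+1, y i]%classic.
have Ur i : (diameter (U i) <= (r i)%:E)%E.
  have [xi yi xyd] := xy i; apply: le_trans (diameter_box xi yi) _.
  by rewrite lee_fin /r -xyd; exact: chord_le.
have cover p : (staircase F t `&` open_unit_square R) p ->
    exists2 i, (i < n.+1)%N & U i p.
  move=> [Sp [/=]]; have [tp1 tp2] := staircase_ge t0 Sp.
  rewrite !in_itv/= => /andP[_ p1] /andP[_ p2].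
  have [||i ni /andP[ui ui1]] := @step_interval _ u n.+1 (p.1 - p.2).
  - by rewrite u0; lra.
  - by rewrite un; lra.
  exists i => //; rewrite /U/= !in_itv/=.
  have [|-> ->] := staircase_diagonal (PS (u i)) Sp; first by rewrite Pu ltW.
  by have [|-> ->] := staircase_diagonal Sp (PS (u i.+1)); first by rewrite Pu.
have Hle := hausdorff1_delta_finite_cover cover (fun i _ => Ur i)
  (fun i _ => le_trans (Ur i) (rd i : ((r i)%:E <= d%:E)%E)) (ltW d0).
have sumr : \sum_(i < n.+1) r i = 2 * (1 - t) - (2 - Num.sqrt 2) * \sum_(i < n.+1) m i.
  by rewrite /r sumrB sumr_const card_ord -[d *+ _]mulr_natl dn -mulr_sumr.
have sumX : (lam (`]t, 1%R] `&` [set s | (F (s, h s) < t - d)%R]) <=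
             (\sum_(i < n.+1) m i)%:E)%E.
  rewrite -sumEFin.
  have mE i : (m i)%:E = lam (`]x i, x i.+1] `&` h @^-1` `]-oo, y i.+1]).
    have [xi _ _] := xy i; rewrite -(cdf_incrl hR) ?PF//.
    by rewrite (le_trans (ltW t0)).
  under eq_bigr do rewrite mE.
  pose V i := `]x i, x i.+1] `&` h @^-1` `]-oo, y i.+1].
  apply: (@content_subadditive _ _ _ lam _ V).
  - by move=> i _; apply: measurableI => //; exact: measurable_preimage_itv.
  - exact: measurable_below_staircase.
  - move=> s [/=]; rewrite in_itv/= => /andP[ts s1] Fs.
    have [||i ni xi] := @step_interval _ x n.+1 s.
    + by have [-> _] := P0.
    + by have [-> _] := Pn.
    rewrite -bigcup_mkord; exists i => //; split; first by rewrite /= in_itv.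
    (* The margin [d] is used here: if [h s] exceeded [y i.+1], then [F (x i.+1, h s)] would be at
       least [t], and moving left to [s] loses less than [d]. *)
    rewrite /= in_itv/= leNgt; apply/negP => yh.
    have /andP[_ si] := xi; have := cdf_lipschitz hR si (lexx (h s)).
    have := cdf_le hR (lexx (x i.+1)) (ltW yh); rewrite PF.
    by have [_ yy xyd] := xy i; have /andP[+ _] := xi; lra.
rewrite -[leRHS](_ : ((\sum_(i < n.+1) r i)%:E +
    ((2 - Num.sqrt 2)%:E * (\sum_(i < n.+1) m i)%:E) = _)%E).
  apply: leeD => //; apply: lee_pmul => //.
  by rewrite lee_fin; lra.
by rewrite -EFinM -EFinD sumr; congr (_%:E); ring.
Qed.

(* The bound at scale [d] only counts the mass where [F < t - d]; let [d] tend to 0. *)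
Lemma hausdorff1_staircase t : 0 < t < 1 ->
  (hausdorff1 (staircase F t `&` open_unit_square R) +
    (2 - Num.sqrt 2)%:E * lam (`]t, 1%R] `&` [set s | (F (s, h s) < t)%R])
    <= (2 * (1 - t))%:E)%E.
Proof.
move=> t01; have /andP[t0 t1] := t01.
have q2 : 0 < 2 - Num.sqrt 2 :> R.
  rewrite subr_gt0 -[ltRHS]ger0_norm// -sqrtr_sqr ltr_sqrt; lra.
pose X (n : nat) := `]t, 1%R] `&` [set s | F (s, h s) < t - 2 * (1 - t) / n.+1%:R].
have mX n : measurable (X n) by exact: measurable_below_staircase.
have XE : \bigcup_n X n = `]t, 1%R] `&` [set s | F (s, h s) < t].
  apply/seteqP; split => s.
    move=> [n _ [ts /= Fs]]; split => //=; apply: (lt_le_trans Fs).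
    by rewrite gerBl divr_ge0// mulr_ge0//; lra.
  move=> [ts /= Fs].
  have d0 : 0 < t - F (s, h s) by lra.
  exists (Num.truncn (2 * (1 - t) / (t - F (s, h s)))) => //; split => //=.
  rewrite ltrBrDr addrC -ltrBrDr ltr_pdivrMr ?ltr0n// [X in _ < X]mulrC -ltr_pdivrMr//.
  exact: truncnS_gt.
have cX : lam \o X @ \oo --> lam (`]t, 1%R] `&` [set s | F (s, h s) < t]).
  rewrite -XE; apply: nondecreasing_cvg_mu => //.
    by apply: bigcup_measurable => n _; exact: mX.
  move=> m n mn; apply/subsetPset => s [ts /= Fs]; split => //=.
  apply: (lt_le_trans Fs); rewrite lerD2l lerN2 ler_wpM2l//; first by rewrite mulr_ge0//; lra.
  by rewrite lef_pV2 ?posrE ?ltr0n// ler_nat.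
have Xfin : ((2 - Num.sqrt 2)%:E *
    lam (`]t, 1%R] `&` [set s | (F (s, h s) < t)%R]))%E \is a fin_num.
  rewrite fin_numM// (@lebesgue_fin_num _ t 1)//.
    exact: measurable_below_staircase.
  by move=> s [/=]; rewrite !in_itv/= => /andP[/ltW -> ->].
rewrite -leeBrDr//.
apply: ge_ereal_sup => _ [d /= d0 <-].
set H := hausdorff1_delta d _.
(* From [n0] on, the mesh [2 * (1 - t) / n.+1%:R] is at most [d], and the premeasure grows as the
   scale shrinks. *)
pose n0 := Num.truncn (2 * (1 - t) / d).
have HX n : (n0 <= n)%N -> (H + (2 - Num.sqrt 2)%:E * lam (X n) <= (2 * (1 - t))%:E)%E.
  move=> n0n; apply: le_trans (hausdorff1_delta_staircase t01
    (erefl _ : _ = 2 * (1 - t) / n.+1%:R)).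
  rewrite leeD2r//; apply: le_hausdorff1_delta.
  rewrite ler_pdivrMr ?ltr0n// [leRHS]mulrC -ler_pdivrMr//.
  by apply/ltW/(lt_le_trans (truncnS_gt _)); rewrite ler_nat ltnS.
have q0 n : (0 <= (2 - Num.sqrt 2)%:E * lam (X n))%E by rewrite mule_ge0// lee_fin ltW.
have Hfin : H \is a fin_num.
  rewrite ge0_fin_numE ?hausdorff1_delta_ge0//.
  apply: (@le_lt_trans _ _ (2 * (1 - t))%:E); last by rewrite ltry.
  by apply: le_trans (HX n0 (leqnn _)); rewrite leeDl.
rewrite leeBrDl// -leeBrDr// -lee_pdivlMl//.
apply: (cvge_to_le cX); exists n0 => // n /= n0n.
by rewrite lee_pdivlMl// leeBrDl//; exact: HX.
Qed.

End staircase_length.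

(** * Inversions *)

Section integral_monotone.
Local Open Scope ereal_scope.
Context d (T : measurableType d) (R : realType) (mu : {measure set T -> \bar R}).
Import HBNNSimple.

(* The library's version asks for the measurability of both integrands, which is
   not available for [level_length]. *)
Lemma ge0_le_integral_nomeas (D : set T) (f g : T -> \bar R) :
  (forall x, D x -> 0 <= f x) -> (forall x, D x -> f x <= g x) ->
  \int[mu]_(x in D) f x <= \int[mu]_(x in D) g x.
Proof.
move=> f0 fg; have g0 x : D x -> 0 <= g x by move=> Dx; exact: le_trans (f0 _ Dx) (fg _ Dx).
rewrite !ge0_integralE//; apply: ereal_sup_le => _ [k kf <-]; exists k => // x.
apply: (le_trans (kf x)); rewrite /patch; case: ifPn => // /set_mem; exact: fg.
Qed.

End integral_monotone.

Lemma measurable_le_set d (T : measurableType d) (R : realType) (f g : T -> R) :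
  measurable_fun setT f -> measurable_fun setT g ->
  measurable [set x | f x <= g x].
Proof.
by move=> mf mg; rewrite -[X in measurable X]setTI; exact: measurable_fun_le.
Qed.

Lemma measurable_lt_set d (T : measurableType d) (R : realType) (f g : T -> R) :
  measurable_fun setT f -> measurable_fun setT g ->
  measurable [set x | f x < g x].
Proof.
move=> mf mg; have -> : [set x | f x < g x] = ~` [set x | g x <= f x].
  by apply/seteqP; split => x /=; rewrite ltNge => /negP.
by apply: measurableC; exact: measurable_le_set.
Qed.

Section planar_measure.
Variable R : realType.

Local Notation lam := (@lebesgue_measure R).
Local Notation lam2 := (lam \x lam)%E.

Lemma lam2_xsection (A : set (R * R)) : lam2 A = (\int[lam]_x lam (xsection A x))%E.
Proof. by []. Qed.

Lemma lam2_ysection (A : set (R * R)) : measurable A ->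
  lam2 A = (\int[lam]_y lam (ysection A y))%E.
Proof.
move=> mA; rewrite (@product_measure_unique _ _ _ _ _ lam lam (lam \x^ lam)%E)//.
by move=> B C mB mC; exact: product_measure2E.
Qed.

(** Exchanges strict and weak inequalities in a section: for an injective map they differ in the
    diagonal point only. *)
Lemma lebesgue_eq_upto_point (S T : set R) (a : R) :
  measurable S -> measurable T -> S `<=` T -> T `<=` S `|` [set a] ->
  lam S = lam T.
Proof.
move=> mS mT ST TS; apply/eqP; rewrite eq_le; apply/andP; split.
  by apply: le_measure; rewrite ?inE.
apply: (@le_trans _ _ (lam (S `|` [set a]))).
  by apply: le_measure; rewrite ?inE//; exact: measurableU.
have Se : (lam (S `|` [set a]) <= lam S + lam [set a])%E by apply: measureU2.
by rewrite lebesgue_measure_set1 adde0 in Se.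
Qed.

(** One half of the square in the coordinates [(x, s)]. The identity gives [s <= x], where the
    derivative of the copula in [y] is 1; [- h] gives [h x <= h s], where its derivative in [x] is
    1. *)
Definition triangle (f : R -> R) : set (R * R) :=
  unit_square R `&` [set p | f p.2 <= f p.1].

Lemma measurable_unit_interval : measurable (unit_interval R).
Proof. exact: measurable_itv. Qed.

Lemma lebesgue_unit_interval : lam (unit_interval R) = 1%E.
Proof. by rewrite (@lebesgue_itv R true false)// subr0. Qed.

Lemma measurable_unit_square : measurable (unit_square R).
Proof. by apply: measurableX; exact: measurable_unit_interval. Qed.

Lemma lam2_unit_square : lam2 (unit_square R) = 1%E.
Proof.
transitivity (lam (unit_interval R) * lam (unit_interval R))%E.
  by apply: product_measure1E; exact: measurable_unit_interval.
by rewrite lebesgue_unit_interval mule1.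
Qed.

Lemma measurable_triangle f : measurable_fun setT f -> measurable (triangle f).
Proof.
move=> mf; apply: measurable_fun_le; first exact: measurable_unit_square.
- by apply: measurable_funTS; apply: measurableT_comp => //; exact: measurable_snd.
- by apply: measurable_funTS; apply: measurableT_comp => //; exact: measurable_fst.
Qed.

(** Exchanging the coordinates maps the set to the one for [- f], which is also its complement up to
    one point in each section. So two sets of equal area fill the square. *)
Lemma lam2_triangle f : measurable_fun setT f -> injective f ->
  lam2 (triangle f) = (2^-1)%:E.
Proof.
move=> mf fI; have mA := measurable_triangle mf.
have mNf : measurable_fun setT (fun x => - f x) by exact: measurableT_comp.
have mA' := measurable_triangle mNf.
have mB : measurable (unit_square R `\` triangle f).
  by apply: measurableD => //; exact: measurable_unit_square.
have AA' : lam2 (triangle (fun x => - f x)) = lam2 (triangle f).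
  rewrite lam2_ysection// lam2_xsection; apply: eq_integral => y _; congr lam.
  apply/seteqP; split => x; rewrite xsectionE ysectionE /triangle/= lerN2 => -[[]];
    by split.
have BA' : lam2 (unit_square R `\` triangle f) = lam2 (triangle (fun x => - f x)).
  rewrite !lam2_xsection; apply: eq_integral => x _.
  apply: (@lebesgue_eq_upto_point _ _ x);
    [exact: measurable_xsection|exact: measurable_xsection|..].
    move=> y; rewrite !xsectionE /triangle/= lerN2 => -[sq ntr]; split => //.
    by rewrite leNgt; apply/negP => /ltW xy; exact: ntr.
  move=> y; rewrite !xsectionE /triangle/= lerN2 => -[sq fxy].
  have [->|xy] := eqVneq y x; first by right.
  left; split => // -[_ fyx]; move/eqP: xy; apply; apply: fI.
  by apply/eqP; rewrite eq_le fxy fyx.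
have : (lam2 (triangle f) + lam2 (triangle f) = 1)%E.
  rewrite -[in X in (_ + X)%E]AA' -BA' -measureU//=.
    by rewrite setDUK ?lam2_unit_square// => p [].
  by rewrite setDIK.
case: (lam2 (triangle f)) => [r| |]//; rewrite -EFinD => /eqP; rewrite eqe => /eqP rr.
by congr (_%:E); lra.
Qed.

Lemma integral_unit_interval_id :
  (\int[lam]_(x in unit_interval R) x%:E = (2^-1)%:E)%E.
Proof.
rewrite -(@lam2_triangle idfun)//; last exact: measurable_id.
rewrite lam2_xsection integral_mkcond; apply: eq_integral => x _.
rewrite patchE; case: ifPn => [/set_mem|/negP xn].
  rewrite /unit_interval/= in_itv/= => /andP[x0 x1].
  rewrite -[X in X%:E]subr0 -(@lebesgue_itv R true false)//; congr lam.
  apply/seteqP; split => y; rewrite xsectionE /triangle/= !in_itv/=.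
    by move=> /andP[y0 yx]; split => //; split; rewrite /unit_interval/= in_itv/=; lra.
  by move=> [[/= _]]; rewrite /unit_interval/= in_itv/= => /andP[-> _] ->.
rewrite [xsection _ _](_ : _ = set0) ?measure0//.
apply/seteqP; split => y //; rewrite xsectionE /triangle/= => -[[/= xI _] _].
by apply: xn; rewrite inE.
Qed.

Lemma integral_unit_interval_onem :
  (\int[lam]_(x in unit_interval R) (1 - x)%:E = (2^-1)%:E)%E.
Proof.
rewrite -(@lam2_triangle (fun x => - x)); [|exact: oppr_measurable|exact: oppr_inj].
rewrite lam2_xsection integral_mkcond; apply: eq_integral => x _.
rewrite patchE; case: ifPn => [/set_mem|/negP xn].
  rewrite /unit_interval/= in_itv/= => /andP[x0 x1].
  rewrite -(@lebesgue_itv R true false)//; congr lam.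
  apply/seteqP; split => y; rewrite xsectionE /triangle/= !in_itv/= lerN2.
    by move=> /andP[y0 yx]; split => //; split; rewrite /unit_interval/= in_itv/=; lra.
  by move=> [[/= _]]; rewrite /unit_interval/= in_itv/= => /andP[_ ->] ->.
rewrite [xsection _ _](_ : _ = set0) ?measure0//.
apply/seteqP; split => y //; rewrite xsectionE /triangle/= => -[[/= xI _] _].
by apply: xn; rewrite inE.
Qed.

End planar_measure.

Section inversions.
Variables (R : realType) (h : R -> R).
Hypothesis hR : rearrangement h.

Local Notation lam := (@lebesgue_measure R).
Local Notation lam2 := (lam \x lam)%E.
Local Notation F := (completely_dependent_copula h).

Let mh : measurable_fun setT h. Proof. by case: hR. Qed.

Definition inversions : set (R * R) :=
  triangle (fun x => x) `&` triangle (fun x => - h x).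

Lemma measurable_inversions : measurable inversions.
Proof.
apply: measurableI; apply: measurable_triangle; first exact: measurable_id.
exact: measurableT_comp.
Qed.

(** With [x] read as [F (x, 1)], the right side is the mass of the points of [[0, x]] whose image
    lies above [h x]. *)
Lemma inversions_xsection x : 0 <= x <= 1 ->
  lam (xsection inversions x) = (x - F (x, h x))%:E.
Proof.
move=> x01; have /andP[x0 x1] := x01.
have [_ _ hin _ hI] := hR; have /andP[hx0 hx1] := hin _ x01.
rewrite -[X in (X - _)%:E](cdf_x1 hR x01) (cdf_incrr hR)//; apply/esym.
apply: (@lebesgue_eq_upto_point _ _ _ x).
- by apply: measurableI => //; exact: measurable_preimage_itv.
- by apply: measurable_xsection; exact: measurable_inversions.
- move=> s; rewrite xsectionE /inversions /triangle/= !in_itv/= lerN2.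
  move=> [/andP[s0 sx] /andP[hxs _]].
  have sq : unit_square R (x, s).
    by split; rewrite /unit_interval/= in_itv/= ?x01 ?s0 ?(le_trans sx).
  by split; split => //; exact: ltW.
- move=> s; rewrite xsectionE /inversions /triangle/= !in_itv/= lerN2.
  move=> [[[_ +] sx] [_ hxs]]; rewrite /unit_interval/= in_itv/= => s01.
  have /andP[s0 s1] := s01; have /andP[hs0 hs1] := hin _ s01.
  have [->|xy] := eqVneq s x; first by right.
  left; rewrite s0 sx hs1 andbT; split => //.
  by rewrite lt_neqAle hxs !andbT; rewrite eq_sym in xy; apply: contra_neq xy => /hI.
Qed.

Lemma inversions_xsection_out x : ~ (0 <= x <= 1) ->
  lam (xsection inversions x) = 0%E.
Proof.
move=> xn; rewrite (_ : xsection _ _ = set0) ?measure0//.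
apply/seteqP; split => // s; rewrite xsectionE /inversions /triangle/=.
by move=> [[[+ _] _] _]; rewrite /unit_interval/= in_itv.
Qed.

Lemma measurable_cdf_graph : measurable_fun setT (fun s => F (s, h s)).
Proof.
apply: (measurableT_comp (measurable_cdf hR)).
by apply: measurable_fun_pair.
Qed.

(** The copula measure is carried by the graph of [h], so the integral here is the one in Kendall's
    tau. The identity holds section by section. *)
Lemma integral_cdf_graph :
  (\int[lam]_(x in unit_interval R) (F (x, h x))%:E + lam2 inversions =
   (2^-1)%:E)%E.
Proof.
rewrite -integral_unit_interval_id lam2_xsection.
have -> : (\int[lam]_x lam (xsection inversions x) =
    \int[lam]_(x in unit_interval R) lam (xsection inversions x))%E.
  rewrite [RHS]integral_mkcond; apply: eq_integral => x _.
  rewrite patchE; case: ifPn => [//|/negP xn].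
  rewrite inversions_xsection_out// => x01; apply: xn.
  by rewrite inE /unit_interval/= in_itv.
rewrite -ge0_integralD//.
- apply: eq_integral => x; rewrite inE /unit_interval/= in_itv/= => x01.
  by rewrite inversions_xsection// -EFinD addrC subrK.
- exact: measurable_unit_interval.
- by move=> x _; rewrite lee_fin (cdf_ge0 hR).
- apply/measurable_funTS; apply/measurable_EFinP; exact: measurable_cdf_graph.
- apply: measurable_funTS; apply: measurable_fun_xsection.
  exact: measurable_inversions.
Qed.

(** Abscissae of the graph points that lie under the level curve, over the range []t, 1]] between
    its end points. *)
Definition below_staircase (t : R) : set R := `]t, 1] `&` [set s | F (s, h s) < t].

Let T : set (R * R) :=
  [set p | p.1 \in `[0, 1]%R] `&` [set p | p.2 \in `]0, 1[%R] `&`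
  ([set p | p.2 < p.1] `&` [set p | F (p.1, h p.1) < p.2]).

Let mT : measurable T.
Proof.
have m1 : measurable_fun [set: R * R] fst by exact: measurable_fst.
have m2 : measurable_fun [set: R * R] snd by exact: measurable_snd.
have mF : measurable_fun [set: R * R] (fun p => F (p.1, h p.1)).
  exact: (measurableT_comp measurable_cdf_graph m1).
apply: measurableI; apply: measurableI.
- by rewrite -[X in measurable X]setTI; exact: (m1 measurableT _ (measurable_itv `[0, 1])).
- by rewrite -[X in measurable X]setTI; exact: (m2 measurableT _ (measurable_itv `]0, 1[)).
- exact: measurable_lt_set.
- exact: measurable_lt_set.
Qed.

Let ysectionT t : t \in `]0, 1[%R -> ysection T t = below_staircase t.
Proof.
move=> t01; apply/seteqP; split => s; rewrite ysectionE /T /below_staircase/= !in_itv/=.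
  by move=> [[/andP[s0 s1] _] [ts Fs]]; rewrite ts s1.
move=> [/andP[ts s1] Fs]; move: t01; rewrite in_itv/= => /andP[t0 t1].
by rewrite ts t0 t1 s1 Fs (ltW (lt_trans t0 ts)).
Qed.

Lemma measurable_fun_below_staircase :
  measurable_fun (`]0, 1[%classic : set R) (fun t => lam (below_staircase t)).
Proof.
apply: (eq_measurable_fun (fun t => lam (ysection T t))) => [t|].
  by rewrite inE/= => t01; rewrite ysectionT.
by apply: measurable_funTS; exact: measurable_fun_ysection.
Qed.

(** Tonelli: the levels that count a given [s] fill the interval from [F (s, h s)] to [s], as long
    as the section of [inversions] at [s]. *)
Lemma integral_below_staircase :
  (\int[lam]_(t in `]0%R, 1%R[) lam (below_staircase t) = lam2 inversions)%E.
Proof.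
transitivity (lam2 T).
  rewrite lam2_ysection// integral_mkcond; apply: eq_integral => t _.
  rewrite patchE; case: ifPn => [|/negP tn].
    by rewrite inE/= => t01; rewrite ysectionT.
  rewrite (_ : ysection _ _ = set0) ?measure0//.
  apply/seteqP; split => // s; rewrite ysectionE /T/= => -[[_ t01] _].
  by apply: tn; rewrite inE.
rewrite !lam2_xsection; apply: eq_integral => s _.
have [s01|/negP sn] := boolP (0 <= s <= 1); last first.
  rewrite inversions_xsection_out// (_ : xsection _ _ = set0) ?measure0//.
  by apply/seteqP; split => // t; rewrite xsectionE /T/= !in_itv/= => -[[]].
rewrite inversions_xsection//; have /andP[s0 s1] := s01.
have Fs := cdf_le_fst hR (h s) s0; have F0 := cdf_ge0 hR s (h s).
rewrite -(@lebesgue_itv R false true)//; congr lam.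
apply/seteqP; split => t; rewrite xsectionE /T/= !in_itv/=.
  by move=> [_ [-> ->]].
by move=> /andP[Ft ts]; rewrite s01 ts Ft (le_lt_trans F0 Ft) (lt_le_trans ts s1).
Qed.

End inversions.

(** * Kendall's tau *)

Section quadrants.
Variable R : realType.

Definition quadrant (p : R * R) : set (R * R) :=
  `]-oo, p.1]%classic `*` `]-oo, p.2]%classic.

Lemma quadrantE a b x y : quadrant (a, b) (x, y) = (x <= a /\ y <= b) :> Prop.
Proof. by rewrite /quadrant/= !in_itv. Qed.

Lemma bigcup_itv_nat : \bigcup_n `]-oo, n%:R]%classic = [set: R].
Proof.
apply/seteqP; split => // x _; exists (Num.truncn `|x|).+1 => //=.
rewrite in_itv/=; apply: (le_trans (ler_norm x)).
by apply/ltW; exact: truncnS_gt.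
Qed.

(** A half-plane is a countable union of quadrants, so both projections are measurable for the
    generated sigma-algebra, which therefore contains all measurable rectangles. *)
Lemma measurable_quadrantE :
  @measurable _ (R * R)%type = <<s range quadrant >>.
Proof.
apply/seteqP; split; last first.
  apply: smallest_sub; first exact: sigma_algebra_measurable.
  by move=> _ [p _ <-]; apply: measurableX.
pose T := g_sigma_algebraType (range quadrant).
have qm p : measurable (quadrant p : set T) by apply: sub_sigma_algebra; exists p.
have mfst : measurable_fun [set: T] (fst : T -> R).
  apply: (@measurability _ _ T R setT fst (@ocitv R)) => // _ [_ [[a b] _ <-] <-].
  have ray x : measurable ([set p | p.1 <= x] : set T).
    rewrite (_ : [set p | p.1 <= x] = \bigcup_n quadrant (x, n%:R)).
      by apply: bigcup_measurable => n _; exact: qm.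
    apply/seteqP; split => [[u v] /= ux|[u v] [n _]].
      have : (\bigcup_n `]-oo, n%:R]%classic) v by rewrite bigcup_itv_nat.
      by move=> [n _ vn]; exists n => //; split => //=; rewrite in_itv.
    by rewrite quadrantE => -[].
  rewrite setTI (_ : _ @^-1` _ = [set p | p.1 <= b] `\` [set p | p.1 <= a]).
    exact: measurableD.
  apply/seteqP; split => -[u v]/=; rewrite in_itv/=.
    by move=> /andP[au ub]; split => //; apply/negP; rewrite -ltNge.
  by move=> [ub /negP]; rewrite -ltNge => ->.
have msnd : measurable_fun [set: T] (snd : T -> R).
  apply: (@measurability _ _ T R setT snd (@ocitv R)) => // _ [_ [[a b] _ <-] <-].
  have ray x : measurable ([set p | p.2 <= x] : set T).
    rewrite (_ : [set p | p.2 <= x] = \bigcup_n quadrant (n%:R, x)).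
      by apply: bigcup_measurable => n _; exact: qm.
    apply/seteqP; split => [[u v] /= ux|[u v] [n _]].
      have : (\bigcup_n `]-oo, n%:R]%classic) u by rewrite bigcup_itv_nat.
      by move=> [n _ vn]; exists n => //; split => //=; rewrite in_itv.
    by rewrite quadrantE => -[].
  rewrite setTI (_ : _ @^-1` _ = [set p | p.2 <= b] `\` [set p | p.2 <= a]).
    exact: measurableD.
  apply/seteqP; split => -[u v]/=; rewrite in_itv/=.
    by move=> /andP[au ub]; split => //; apply/negP; rewrite -ltNge.
  by move=> [ub /negP]; rewrite -ltNge => ->.
rewrite measurable_prod_measurableType; apply: smallest_sub.
  exact: smallest_sigma_algebra.
move=> _ [A mA [B mB <-]].
rewrite (_ : A `*` B = (fst @^-1` A) `&` (snd @^-1` B))//.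
apply: (@measurableI _ T).
  by rewrite -[X in measurable X]setTI; exact: mfst.
by rewrite -[X in measurable X]setTI; exact: msnd.
Qed.

Lemma probability_quadrant_unique (P Q : probability (R * R)%type R) :
  (forall p, P (quadrant p) = Q (quadrant p)) ->
  forall S : set (R * R), measurable S -> P S = Q S.
Proof.
move=> PQ S mS.
apply: (@measure_unique _ _ _ (range quadrant) (fun n => quadrant (n%:R, n%:R))) => //.
- exact: measurable_quadrantE.
- move=> _ _ [[a b] _ <-] [[c d] _ <-]; exists (Num.min a c, Num.min b d) => //.
  apply/seteqP; split => -[x y]; rewrite /setI/= !quadrantE !le_min.
    by move=> [/andP[-> ->] /andP[-> ->]].
  by move=> [[-> ->] [-> ->]].
- apply/seteqP; split => // -[x y] _.
  have : (\bigcup_n `]-oo, n%:R]%classic) (Num.max x y) by rewrite bigcup_itv_nat.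
  move=> [n _]; rewrite /= in_itv/= ge_max => /andP[xn yn].
  by exists n => //; rewrite quadrantE.
- by move=> _ [p _ <-]; exact: PQ.
- move=> n; apply: (@le_lt_trans _ _ 1%E); last by rewrite ltry.
  by apply: probability_le1; apply: measurableX.
Qed.

(** Since [A (1, 1) = 1], the measure is carried by the square, where a quadrant cuts out either
    nothing or a rectangle with a corner at the origin. *)
Lemma copula_measure_quadrant (A : R * R -> R) (P : probability (R * R)%type R) :
  is_copula_measure A P -> A (1, 1) = 1 -> forall p,
  P (quadrant p) = if (0 <= p.1) && (0 <= p.2)
    then (A (Num.min p.1 1, Num.min p.2 1))%:E else 0%E.
Proof.
move=> PA A1 [a b] /=.
have mS := @measurable_unit_square R.
have mq : measurable (quadrant (a, b)) by apply: measurableX.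
have P1 : P (unit_square R) = 1%E.
  by rewrite /unit_square /unit_interval PA ?A1// in_itv/= lexx ler01.
have Pc : P (~` unit_square R) = 0%E.
  by rewrite probability_setC// P1 subee.
have -> : P (quadrant (a, b)) = P (quadrant (a, b) `&` unit_square R).
  apply/eqP; rewrite eq_le; apply/andP; split; last first.
    by apply: le_measure; rewrite ?inE//; exact: measurableI.
  rewrite -[leRHS]adde0 -Pc -[X in (_ <= _ X + _)%E]setIC.
  apply: (@le_trans _ _ (P ((unit_square R `&` quadrant (a, b)) `|` ~` unit_square R))).
    apply: le_measure; rewrite ?inE//.
      by apply: measurableU; [exact: measurableI|exact: measurableC].
    by move=> p qp; have [sp|sp] := pselect (unit_square R p); [left|right].
  by apply: measureU2; [exact: measurableI|exact: measurableC].
case: ifPn => [/andP[a0 b0]|ab]; last first.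
  rewrite (_ : _ `&` _ = set0) ?measure0//; apply/seteqP; split => // -[x y].
  rewrite /setI/= quadrantE => -[[xa yb]] [/=]; rewrite /unit_interval/= !in_itv/=.
  by move=> /andP[x0 _] /andP[y0 _]; move/negP: ab; rewrite (le_trans x0)// (le_trans y0).
rewrite -PA; last 2 first.
- by rewrite in_itv/= le_min a0 ler01 ge_min lexx orbT.
- by rewrite in_itv/= le_min b0 ler01 ge_min lexx orbT.
congr (P _); apply/seteqP; split => -[x y];
    rewrite /setI/= quadrantE /unit_square /unit_interval/= !in_itv/= !le_min.
  by move=> [[-> ->] [/andP[-> ->] /andP[-> ->]]].
by move=> [/andP[-> /andP[-> ->]] /andP[-> /andP[-> ->]]].
Qed.

Lemma copula_measure_unique (A : R * R -> R) (P Q : probability (R * R)%type R) :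
  is_copula_measure A P -> is_copula_measure A Q -> A (1, 1) = 1 ->
  forall S : set (R * R), measurable S -> P S = Q S.
Proof.
move=> PA QA A1; apply: probability_quadrant_unique => p.
by rewrite (copula_measure_quadrant PA)// (copula_measure_quadrant QA).
Qed.

End quadrants.

Section kendall.
Variables (R : realType) (h : R -> R).
Hypothesis hR : rearrangement h.

Local Notation lam := (@lebesgue_measure R).
Local Notation lam2 := (lam \x lam)%E.
Local Notation F := (completely_dependent_copula h).

Let mh : measurable_fun setT h. Proof. by case: hR. Qed.

Let graph (s : R) : R * R := (s, h s).

Let mgraph : measurable_fun setT graph.
Proof. exact: measurable_fun_pair. Qed.

(** The law of [(X, h X)] for [X] uniform on [[0, 1]]. Its existence shows that [copula_measure] is
    not the default Dirac mass. *)
Let nu (S : set (R * R)) : \bar R := lam (graph @^-1` S `&` unit_interval R).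

Let mgraph_preimage (S : set (R * R)) : measurable S -> measurable (graph @^-1` S).
Proof. by move=> mS; rewrite -[X in measurable X]setTI; exact: mgraph. Qed.

Let nu0 : nu set0 = 0%E.
Proof. by rewrite /nu preimage_set0 set0I measure0. Qed.

Let nu_ge0 S : (0 <= nu S)%E.
Proof. exact: measure_ge0. Qed.

Let nu_sigma_additive : semi_sigma_additive nu.
Proof.
move=> E mE tE mUE; rewrite /nu preimage_bigcup setI_bigcupl.
have mI := @measurable_unit_interval R.
apply: measure_semi_sigma_additive.
- by move=> n; apply: measurableI => //; exact: mgraph_preimage.
- apply/trivIsetP => /= i j _ _ ij; rewrite setIACA -preimage_setI.
  by move/trivIsetP : tE => /(_ _ _ _ _ ij) ->//; rewrite preimage_set0 set0I.
- apply: bigcup_measurable => n _.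
  by apply: measurableI => //; exact: mgraph_preimage.
Qed.

Let nu_setT : nu setT = 1%E.
Proof. by rewrite /nu preimage_setT setTI lebesgue_unit_interval. Qed.

HB.instance Definition _ := isMeasure.Build _ _ _ nu nu0 nu_ge0 nu_sigma_additive.
HB.instance Definition _ := Measure_isProbability.Build _ _ _ nu nu_setT.

Let nuF (A : R * R -> R) : (forall p, unit_square R p -> A p = F p) ->
  is_copula_measure A nu.
Proof.
move=> AF x y; rewrite !in_itv/= => x01 y01.
rewrite AF; last by split; rewrite /unit_interval/= in_itv.
rewrite cdf_setE//; congr lam; apply/seteqP; split => s;
    rewrite /cdf_set /graph /unit_interval/= !in_itv/=.
  by move=> [[/andP[-> ->] /andP[_ ->]]].
move=> [/andP[s0 sx] hsy]; have /andP[_ x1] := x01.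
by rewrite s0 sx hsy (rearrangement_ge0 hR s0) (le_trans sx x1).
Qed.

Lemma kendall_tauE (A : R * R -> R) :
  (forall p, unit_square R p -> A p = F p) ->
  ((kendall_tau A)%:E = 1 - 4%:E * lam2 (inversions h))%E.
Proof.
move=> AF.
have A1 : A (1, 1) = 1.
  rewrite AF; last by split; rewrite /unit_interval/= in_itv/= lexx ler01.
  by rewrite (cdf_x1 hR)// lexx ler01.
have muA : is_copula_measure A (copula_measure A).
  by apply: xgetPex; exists (nu : probability (R * R)%type R); exact: nuF.
have mSq := @measurable_unit_square R.
have tauA : kendall_tau A =
    4 * fine (\int[lam]_(x in unit_interval R) (F (x, h x))%:E)%E - 1.
  rewrite /kendall_tau /Rintegral; congr (4 * fine _ - 1).
  transitivity (\int[copula_measure A]_(p in unit_square R) (F p)%:E)%E.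
    by apply: eq_integral => p; rewrite inE => /AF ->.
  (* On subsets of the square this pushforward agrees with [nu], hence with the copula measure by
     uniqueness. *)
  transitivity (\int[pushforward lam graph]_(p in unit_square R) (F p)%:E)%E.
    apply: eq_measure_integral => S mS SI.
    transitivity (nu S); first exact: (copula_measure_unique muA (nuF AF) A1 mS).
    by rewrite /= /pushforward /nu; congr lam; rewrite setIidl// => s /SI [].
  rewrite ge0_integral_pushforward//.
  - congr integral; apply/seteqP; split => s; rewrite /graph /unit_square/=; first by case.
    have [_ _ hin _ _] := hR.
    by rewrite /unit_interval/= !in_itv/= => s01; split => //; rewrite hin.
  - by apply/measurable_funTS/measurable_EFinP; exact: measurable_cdf.
  - by move=> [x y] _; rewrite lee_fin cdf_ge0.
rewrite tauA; have := integral_cdf_graph hR.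
case: (\int[lam]_(x in _) _)%E => [r| |]; case: (lam2 _) => [q| |]//=.
rewrite -EFinD => /eqP; rewrite eqe => /eqP rq.
by rewrite -EFinD; congr (_%:E); lra.
Qed.

End kendall.

(** * Lower bound for the length of a staircase *)

(** Cauchy-Schwarz through Lagrange's identity. *)
Lemma weighted_sum_le_sqrt (R : rcfType) (a b z w : R) : a ^+ 2 + b ^+ 2 <= 1 ->
  a * z + b * w <= Num.sqrt (z ^+ 2 + w ^+ 2).
Proof.
move=> ab; apply: (le_trans (ler_norm _)); rewrite -sqrtr_sqr ler_wsqrtr//.
rewrite -subr_ge0.
have -> : z ^+ 2 + w ^+ 2 - (a * z + b * w) ^+ 2 =
  (1 - (a ^+ 2 + b ^+ 2)) * (z ^+ 2 + w ^+ 2) + (a * w - b * z) ^+ 2 by ring.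
by rewrite addr_ge0 ?sqr_ge0// mulr_ge0 ?subr_ge0// addr_ge0 ?sqr_ge0.
Qed.

(* [sup set0 = inf set0 = 0], so that the empty set has width 0. *)
Definition width (R : realType) (S : set R) : R := sup S - inf S.

Lemma width0 (R : realType) : width (set0 : set R) = 0.
Proof. by rewrite /width sup0 inf0 subrr. Qed.

Lemma sub_hull (R : realType) (S : set R) (a b : R) :
  S `<=` `[a, b] -> S `<=` `[inf S, sup S].
Proof.
move=> Sab x Sx; rewrite /= in_itv/=; apply/andP; split.
  by apply: ge_inf => //; exists a => y /Sab; rewrite /= in_itv/= => /andP[].
by apply: ub_le_sup => //; exists b => y /Sab; rewrite /= in_itv/= => /andP[].
Qed.

Lemma width_ge0 (R : realType) (S : set R) (a b : R) :
  S `<=` `[a, b] -> 0 <= width S.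
Proof.
move=> Sab; have [[x Sx]|/set0P/negP/negPn/eqP ->] := pselect (S !=set0).
  by have := sub_hull Sab Sx; rewrite /= in_itv/= subr_ge0 => /andP[]; exact: le_trans.
by rewrite width0.
Qed.

Section staircase_lower_bound.
Variables (R : realType) (F : R * R -> R).
Hypothesis F_le : forall x y x' y', x <= x' -> y <= y' -> F (x, y) <= F (x', y').
Hypothesis F_lipschitz : forall x y x' y', x <= x' -> y <= y' ->
  F (x', y') <= F (x, y) + (x' - x) + (y' - y).
Hypothesis mF : measurable_fun setT F.

Local Notation lam := (@lebesgue_measure R).

(* On an antitone set both the abscissa and the negated ordinate increase with
   [p.1 - p.2], so their oscillations are attained at the same pair of points. *)
Lemma staircase_spread t (V : set (R * R)) (d a b : R) :
  V `<=` staircase F t -> (diameter V <= d%:E)%E ->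
  0 <= a -> 0 <= b -> a ^+ 2 + b ^+ 2 <= 1 ->
  forall p q p' q', V p -> V q -> V p' -> V q' ->
    a * (p.1 - q.1) + b * (p'.2 - q'.2) <= d.
Proof.
move=> VS Vd a0 b0 ab p q p' q' Vp Vq Vp' Vq'.
(* [lo] is the earlier of [q] and [p'] along the curve, and [hi] the later of [p] and [q']. *)
have [lo [Vlo lo1 lo2]] : exists lo, [/\ V lo, lo.1 <= q.1 & p'.2 <= lo.2].
  have [u|/ltW u] := leP (q.1 - q.2) (p'.1 - p'.2).
    by exists q; split => //; have [] := staircase_diagonal (VS _ Vq) (VS _ Vp') u.
  by exists p'; split => //; have [] := staircase_diagonal (VS _ Vp') (VS _ Vq) u.
have [hi [Vhi hi1 hi2]] : exists hi, [/\ V hi, p.1 <= hi.1 & hi.2 <= q'.2].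
  have [u|/ltW u] := leP (p.1 - p.2) (q'.1 - q'.2).
    by exists q'; split => //; have [] := staircase_diagonal (VS _ Vp) (VS _ Vq') u.
  by exists p; split => //; have [] := staircase_diagonal (VS _ Vq') (VS _ Vp) u.
apply: (@le_trans _ _ (a * (hi.1 - lo.1) + b * (lo.2 - hi.2))).
  by apply: lerD; apply: ler_wpM2l => //; lra.
apply: (le_trans (weighted_sum_le_sqrt _ _ ab)).
have := le_trans (euclidean_dist_le_diameter Vhi Vlo) Vd.
by rewrite lee_fin /euclidean_dist -[(hi.2 - lo.2) ^+ 2]sqrrN opprB.
Qed.

(** Passes from pairs of points to the hulls of the projections. Suprema and infima are approached
    within [e / 4]; as [a] and [b] are at most 1, the four errors add up to at most [e]. *)
Lemma staircase_width t (V : set (R * R)) (d a b : R) (x1 x2 y1 y2 : R) :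
  V `<=` staircase F t -> V `<=` `[x1, x2]%classic `*` `[y1, y2]%classic ->
  (diameter V <= d%:E)%E ->
  0 <= a -> 0 <= b -> a ^+ 2 + b ^+ 2 <= 1 ->
  a * width (fst @` V) + b * width (snd @` V) <= d.
Proof.
move=> VS VQ Vd a0 b0 ab.
have d0 : 0 <= d by have := le_trans (diameter_ge0 V) Vd; rewrite lee_fin.
have [V0|/set0P/negP/negPn/eqP ->] := pselect (V !=set0); last first.
  by rewrite !image_set0 !width0 !mulr0 addr0.
have a1 : a <= 1.
  by rewrite -(@ler_pXn2r _ 2)// ?nnegrE// expr1n; have := sqr_ge0 b; lra.
have b1 : b <= 1.
  by rewrite -(@ler_pXn2r _ 2)// ?nnegrE// expr1n; have := sqr_ge0 a; lra.
have V1 : fst @` V `<=` `[x1, x2] by move=> _ [p /VQ[Vp _] <-].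
have V2 : snd @` V `<=` `[y1, y2] by move=> _ [p /VQ[_ Vp] <-].
have W1 : fst @` V !=set0 by case: V0 => p Vp; exists p.1; exists p.
have W2 : snd @` V !=set0 by case: V0 => p Vp; exists p.2; exists p.
have s1 : has_sup (fst @` V).
  by split => //; exists x2 => x /V1; rewrite /= in_itv/= => /andP[].
have i1 : has_inf (fst @` V).
  by split => //; exists x1 => x /V1; rewrite /= in_itv/= => /andP[].
have s2 : has_sup (snd @` V).
  by split => //; exists y2 => x /V2; rewrite /= in_itv/= => /andP[].
have i2 : has_inf (snd @` V).
  by split => //; exists y1 => x /V2; rewrite /= in_itv/= => /andP[].
apply/ler_addgt0Pr => e e0.
have e4 : 0 < e / 4 by lra.
have [_ [p Vp <-] pe] := sup_adherent e4 s1.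
have [_ [q Vq <-] qe] := inf_adherent e4 i1.
have [_ [p' Vp' <-] p'e] := sup_adherent e4 s2.
have [_ [q' Vq' <-] q'e] := inf_adherent e4 i2.
have := staircase_spread VS Vd a0 b0 ab Vp Vq Vp' Vq'.
have H1 : a * width (fst @` V) <= a * (p.1 - q.1) + e / 2.
  apply: (@le_trans _ _ (a * (p.1 - q.1 + e / 2))).
    by apply: ler_wpM2l => //; rewrite /width; lra.
  by rewrite mulrDr lerD2l ler_piMl//; lra.
have H2 : b * width (snd @` V) <= b * (p'.2 - q'.2) + e / 2.
  apply: (@le_trans _ _ (b * (p'.2 - q'.2 + e / 2))).
    by apply: ler_wpM2l => //; rewrite /width; lra.
  by rewrite mulrDr lerD2l ler_piMl//; lra.
lra.
Qed.

(** A measurable part of the projection of the curve inside the box: on these vertical segments the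
    level is crossed between the lower and the upper side. *)
Definition crossing_x (t x1 x2 y1 y2 : R) : set R :=
  `[x1, x2] `&` [set x | F (x, y1) < t <= F (x, y2)].

Definition crossing_y (t x1 x2 y1 y2 : R) : set R :=
  `[y1, y2] `&` [set y | F (x1, y) < t <= F (x2, y)].

Lemma measurable_crossing_x t x1 x2 y1 y2 : measurable (crossing_x t x1 x2 y1 y2).
Proof.
have mFx y : measurable_fun setT (fun x => F (x, y)).
  apply: (measurableT_comp mF); apply: measurable_fun_pair => //.
apply: measurableI => //.
have -> : [set x | F (x, y1) < t <= F (x, y2)] =
    [set x | F (x, y1) < t] `&` [set x | t <= F (x, y2)].
  by apply/seteqP; split => x /=; [move/andP|move=> []-> ->].
apply: measurableI; first exact: measurable_lt_set.
exact: measurable_le_set.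
Qed.

Lemma measurable_crossing_y t x1 x2 y1 y2 : measurable (crossing_y t x1 x2 y1 y2).
Proof.
have mFy x : measurable_fun setT (fun y => F (x, y)).
  apply: (measurableT_comp mF); apply: measurable_fun_pair => //.
apply: measurableI => //.
have -> : [set y | F (x1, y) < t <= F (x2, y)] =
    [set y | F (x1, y) < t] `&` [set y | t <= F (x2, y)].
  by apply/seteqP; split => x /=; [move/andP|move=> []-> ->].
apply: measurableI; first exact: measurable_lt_set.
exact: measurable_le_set.
Qed.

Lemma crossing_x_sub t x1 x2 y1 y2 : crossing_x t x1 x2 y1 y2 `<=`
  fst @` (staircase F t `&` (`[x1, x2]%classic `*` `[y1, y2]%classic)).
Proof.
move=> x [xI /= /andP[Fy1 Fy2]].
have [|||||y [y1y yy2 Fy lt]] := @first_crossing R (fun y => F (x, y)) 1 t y1 y2.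
- by [].
- by move=> y y' yy'; exact: F_le.
- move=> y y' yy'; have := F_lipschitz (lexx x) yy'; lra.
- by [].
- by [].
exists (x, y) => //; split; last by split => //=; rewrite in_itv/= (ltW y1y).
split => /=; first by rewrite Fy.
by move=> x' y' x'x y'y; apply: (le_lt_trans _ (lt _ y'y)); apply: F_le => //; exact: ltW.
Qed.

Lemma crossing_y_sub t x1 x2 y1 y2 : crossing_y t x1 x2 y1 y2 `<=`
  snd @` (staircase F t `&` (`[x1, x2]%classic `*` `[y1, y2]%classic)).
Proof.
move=> y [yI /= /andP[Fx1 Fx2]].
have [|||||x [x1x xx2 Fx lt]] := @first_crossing R (fun x => F (x, y)) 1 t x1 x2.
- by [].
- by move=> x x' xx'; exact: F_le.
- move=> x x' xx'; have := F_lipschitz xx' (lexx y); lra.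
- by [].
- by [].
exists (x, y) => //; split; last by split => //=; rewrite in_itv/= (ltW x1x).
split => /=; first by rewrite Fx.
by move=> x' y' x'x y'y; apply: (le_lt_trans _ (lt _ x'x)); apply: F_le => //; exact: ltW.
Qed.

Lemma le_lebesgue_width (D : set R) (W : nat -> set R) (a b : R) :
  measurable D -> D `<=` \bigcup_j W j -> (forall j, W j `<=` `[a, b]) ->
  (lam D <= \sum_(0 <= j <oo) (width (W j))%:E)%E.
Proof.
move=> mD DW Wab.
apply: (@le_trans _ _ (\sum_(0 <= j <oo) lam `[inf (W j), sup (W j)]%classic)%E).
  apply: measure_sigma_subadditive => //.
  by move=> x /DW[j _ Wx]; exists j => //; exact: (sub_hull (Wab j)).
apply: lee_nneseries => // j _.
have := width_ge0 (Wab j); rewrite subr_ge0 => ij.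
by rewrite lebesgue_itv.
Qed.

Section boxes.
Variables (I : finType) (t eta : R) (x1 x2 y1 y2 a b : I -> R).
Let box k : set (R * R) := `[x1 k, x2 k]%classic `*` `[y1 k, y2 k]%classic.
Hypothesis eta0 : 0 < eta.
Hypothesis box_sub : forall k, box k `<=` open_unit_square R.
Hypothesis box_sep : forall k k' p p', k != k' -> box k p -> box k' p' ->
  eta < euclidean_dist p p'.
Hypothesis a0 : forall k, 0 <= a k.
Hypothesis b0 : forall k, 0 <= b k.
Hypothesis ab : forall k, a k ^+ 2 + b k ^+ 2 <= 1.

(** At scale [eta] a covering set meets at most one box, so its diameter pays for the weighted
    widths of its trace in that box alone. Summed over the cover, these widths exceed the measures
    of the projections. *)
Lemma hausdorff1_staircase_ge :
  (\sum_k ((a k)%:E * lam (crossing_x t (x1 k) (x2 k) (y1 k) (y2 k)) +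
           (b k)%:E * lam (crossing_y t (x1 k) (x2 k) (y1 k) (y2 k)))
   <= hausdorff1 (staircase F t `&` open_unit_square R))%E.
Proof.
set S := staircase F t `&` _.
apply: (@le_trans _ _ (hausdorff1_delta eta S)); last first.
  by apply: ereal_sup_ubound; exists eta.
apply: le_ereal_inf_tmp => _ [U [SU Ud] <-].
pose V j k := U j `&` (staircase F t `&` box k).
have V1 j k : fst @` V j k `<=` `[x1 k, x2 k] by move=> _ [p [_ [_ [Vp _]]] <-].
have V2 j k : snd @` V j k `<=` `[y1 k, y2 k] by move=> _ [p [_ [_ [_ Vp]]] <-].
pose w j k := a k * width (fst @` V j k) + b k * width (snd @` V j k).
have w0 j k : 0 <= w j k.
  by rewrite addr_ge0// mulr_ge0//; [exact: width_ge0 (V1 j k)|exact: width_ge0 (V2 j k)].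
apply: (@le_trans _ _ (\sum_k \sum_(0 <= j <oo) (w j k)%:E)%E).
  apply: lee_sum => k _.
  have DW1 : (lam (crossing_x t (x1 k) (x2 k) (y1 k) (y2 k)) <=
      \sum_(0 <= j <oo) (width (fst @` V j k))%:E)%E.
    apply: (@le_lebesgue_width _ (fun j => fst @` V j k) (x1 k) (x2 k)) => //.
      exact: measurable_crossing_x.
    move=> x /crossing_x_sub[p [Sp pQ] <-].
    have [j _ Ujp] := SU _ (conj Sp (box_sub pQ)).
    by exists j => //; exists p.
  have DW2 : (lam (crossing_y t (x1 k) (x2 k) (y1 k) (y2 k)) <=
      \sum_(0 <= j <oo) (width (snd @` V j k))%:E)%E.
    apply: (@le_lebesgue_width _ (fun j => snd @` V j k) (y1 k) (y2 k)) => //.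
      exact: measurable_crossing_y.
    move=> x /crossing_y_sub[p [Sp pQ] <-].
    have [j _ Ujp] := SU _ (conj Sp (box_sub pQ)).
    by exists j => //; exists p.
  under eq_eseriesr do rewrite /w EFinD !EFinM.
  rewrite nneseriesD; last 2 first.
  - by move=> j _ _; rewrite -EFinM lee_fin mulr_ge0//; exact: width_ge0 (V1 j k).
  - by move=> j _ _; rewrite -EFinM lee_fin mulr_ge0//; exact: width_ge0 (V2 j k).
  rewrite !nneseriesZl; last 2 first.
  - by move=> j _; rewrite lee_fin; exact: width_ge0 (V2 j k).
  - by move=> j _; rewrite lee_fin; exact: width_ge0 (V1 j k).
  by apply: leeD; apply: lee_wpmul2l => //; rewrite lee_fin.
rewrite -nneseries_sum; last by move=> j k _; rewrite lee_fin.
apply: lee_nneseries => [j _ _|j _]; first by rewrite sume_ge0// => k _; rewrite lee_fin.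
have Ufin : diameter (U j) \is a fin_num.
  by rewrite ge0_fin_numE ?diameter_ge0// (le_lt_trans (Ud j))// ltry.
have [[k0 [p0 Vp0]]|noV] := pselect (exists k, V j k !=set0); last first.
  rewrite big1 ?diameter_ge0// => k _; rewrite /w.
  have -> : V j k = set0 by apply/seteqP; split => // p Vp; apply: noV; exists k, p.
  by rewrite !image_set0 !width0 !mulr0 addr0.
rewrite (bigD1 k0)//= big1 ?adde0 => [|k kk0]; last first.
  rewrite /w; have -> : V j k = set0.
    apply/seteqP; split => // p [Up [_ pQ]].
    have [Up0 [_ p0Q]] := Vp0.
    have := le_trans (euclidean_dist_le_diameter Up Up0) (Ud j).
    by rewrite lee_fin leNgt (box_sep kk0 pQ p0Q).
  by rewrite !image_set0 !width0 !mulr0 addr0.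
rewrite -(fineK Ufin) lee_fin.
apply: (@staircase_width t (V j k0) _ _ _ (x1 k0) (x2 k0) (y1 k0) (y2 k0)) => //.
- by move=> p [_ []].
- by move=> p [_ []].
- rewrite fineK//; apply: ereal_sup_le => _ [->|[p Vp [q Vq <-]]]; first by left.
  by right; exists p; [case: Vp|exists q => //; case: Vq].
Qed.

End boxes.

End staircase_lower_bound.

(** * Integration over the levels *)

(** Uniform continuity of [f] as a function of [g]. With [g] the identity it concerns [h], with [f]
    the identity the inverse of [h]. *)
Lemma injective_compact_modulus (R : realType) (K : set R) (f g : R -> R) (e : R) :
  compact K -> {within K, continuous f} -> {within K, continuous g} ->
  (forall x y, K x -> K y -> g x = g y -> x = y) -> 0 < e ->
  exists2 d, 0 < d & forall x y, K x -> K y ->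
    `|g x - g y| < d -> `|f x - f y| < e.
Proof.
move=> cK cf cg gI e0.
have [K0|/set0P/negP/negPn/eqP ->] := pselect (K !=set0); last by exists 1.
pose dist (u : R -> R) (p : R * R) := `|u p.1 - u p.2|.
(* The second summand is twice the positive part of [e - dist f p]. So [psi] equals [dist g] where
   [dist f] is at least [e], and it vanishes nowhere on [K * K]; its minimum is the modulus. *)
pose psi p := dist g p + (`|e - dist f p| + (e - dist f p)).
have cdist (u : R -> R) : {within K, continuous u} ->
    forall p, (K `*` K) p -> dist u @ within (K `*` K) (nbhs p) --> dist u p.
  move=> /subspace_continuousP cu [x y] [/= Kx Ky].
  apply: cvg_norm; apply: cvgB.
  - apply: (cvg_comp _ _ _ (cu x Kx)) => A; rewrite /within/= => xA.
    change (nbhs ((x, y) : R * R) [set q | (K `*` K) q -> A q.1]).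
    exists ([set z | K z -> A z], setT); first by split => //; exact: filterT.
    by move=> [u' v'] [/= qA _] [/qA].
  - apply: (cvg_comp _ _ _ (cu y Ky)) => A; rewrite /within/= => xA.
    change (nbhs ((x, y) : R * R) [set q | (K `*` K) q -> A q.2]).
    exists (setT, [set z | K z -> A z]); first by split => //; exact: filterT.
    by move=> [u' v'] [/= _ qA] [_ /qA].
have cpsi : {within K `*` K, continuous psi}.
  apply/subspace_continuousP => p Kp.
  have ce : (fun q => e - dist f q) @ within (K `*` K) (nbhs p) --> e - dist f p.
    by apply: cvgB; [exact: cvg_cst|exact: cdist].
  by apply: cvgD; [exact: cdist|apply: cvgD => //; exact: cvg_norm].
have [c /set_mem[Kc1 Kc2] cmin] := compact_EVT_min
  (let: ex_intro x Kx := K0 in ex_intro (K `*` K) (x, x) (conj Kx Kx))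
  (compact_setX cK cK) cpsi.
have psi_gt0 : 0 < psi c.
  have [gc|gc] := eqVneq (g c.1) (g c.2).
    have cc := gI _ _ Kc1 Kc2 gc.
    by rewrite /psi /dist cc !subrr normr0 subr0 gtr0_norm// add0r addr_gt0.
  rewrite ltr_wpDr//; last by rewrite normr_gt0 subr_eq0.
  by have := ler_norm (- (e - dist f c)); rewrite normrN; lra.
exists (psi c) => // x y Kx Ky gxy; rewrite ltNge; apply/negP => fxy.
have := cmin (x, y) (mem_set (conj Kx Ky)).
rewrite leNgt /psi /dist/= in gxy *; rewrite [`|e - _|]ler0_norm; last by rewrite subr_le0.
by rewrite addNr addr0 gxy.
Qed.

Section integrated_length.
Variables (R : realType) (h : R -> R).
Hypothesis hR : rearrangement h.

Local Notation lam := (@lebesgue_measure R).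
Local Notation lam2 := (lam \x lam)%E.
Local Notation F := (completely_dependent_copula h).

Let mh : measurable_fun setT h. Proof. by case: hR. Qed.

Local Notation len t := (hausdorff1 (staircase F t `&` open_unit_square R)).

Lemma integral_open_interval_double_onem :
  (\int[lam]_(t in `]0%R, 1%R[) (2 * (1 - t))%:E = 1)%E.
Proof.
under eq_integral do rewrite EFinM.
have mo : measurable_fun [set: R] (fun t : R => (1 - t)%:E).
  by apply/measurable_EFinP; apply: measurable_funB => //; exact: measurable_cst.
rewrite ge0_integralZl//=; last 2 first.
- exact: measurable_funTS.
- by move=> t; rewrite in_itv/= lee_fin => /andP[_ t1]; rewrite subr_ge0 ltW.
rewrite integral_itv_bndo_bndc; last exact: measurable_funTS.
rewrite integral_itv_obnd_cbnd; last exact: measurable_funTS.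
by rewrite [X in (_ * X)%E]integral_unit_interval_onem -EFinM mulfV.
Qed.

Lemma integral_staircase_le :
  (\int[lam]_(t in `]0%R, 1%R[) len t + (2 - Num.sqrt 2)%:E * lam2 (inversions h)
    <= 1)%E.
Proof.
have q2 : 0 <= 2 - Num.sqrt 2 :> R.
  by rewrite subr_ge0 -[leRHS]ger0_norm// -sqrtr_sqr ler_wsqrtr//; lra.
have fin t : (0 < t < 1)%R -> ((2 - Num.sqrt 2)%:E * lam (below_staircase h t))%E \is a fin_num.
  move=> t01; rewrite fin_numM// (@lebesgue_fin_num _ t 1)//.
    exact: measurable_below_staircase.
  by move=> s [/=]; rewrite !in_itv/= => /andP[/ltW -> ->].
have mc : measurable_fun (`]0, 1[%classic : set R)
    (fun t => (2 - Num.sqrt 2)%:E * lam (below_staircase h t))%E.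
  by apply: emeasurable_funM => //; exact: measurable_fun_below_staircase.
have mo : measurable_fun (`]0, 1[%classic : set R) (fun t : R => (2 * (1 - t))%:E).
  apply/measurable_EFinP; apply: measurable_funM => //.
  by apply: measurable_funB => //; exact: measurable_cst.
(* Additivity of the integral is applied to the measurable bound [G] in place of [len]. *)
pose G t := ((2 * (1 - t))%:E - (2 - Num.sqrt 2)%:E * lam (below_staircase h t))%E.
have lenG t : t \in `]0, 1[%R -> (len t <= G t)%E.
  by rewrite in_itv/= => t01; rewrite /G leeBrDr ?fin//; exact: hausdorff1_staircase.
have len0 t : (0 <= len t)%E by exact: hausdorff1_ge0.
rewrite -integral_open_interval_double_onem -(integral_below_staircase hR).
rewrite -ge0_integralZl//; last exact: measurable_fun_below_staircase.
apply: (@le_trans _ _ (\int[lam]_(t in `]0%R, 1%R[) G t +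
   \int[lam]_(t in `]0%R, 1%R[) ((2 - Num.sqrt 2)%:E * lam (below_staircase h t)))%E).
  by rewrite leeD2r//; apply: ge0_le_integral_nomeas => t //; exact: lenG.
rewrite -ge0_integralD//.
- rewrite le_eqVlt; apply/orP; left; apply/eqP; apply: eq_integral => t.
  by rewrite inE/= in_itv/= => t01; rewrite /G subeK// fin.
- by move=> t t01; exact: le_trans (lenG t t01).
- exact: emeasurable_funB.
- by move=> t _; rewrite mule_ge0.
Qed.

(* The box [`]x1, x2] `*` `]y1, y2]] of the copula plane, with its ordinates [y]
   replaced by the abscissae [s] such that [y = h s]. *)
Definition cell (x1 x2 y1 y2 : R) : set (R * R) :=
  `]x1, x2]%classic `*` (h @^-1` `]y1, y2]).

Lemma measurable_cell (x1 x2 y1 y2 : R) : measurable (cell x1 x2 y1 y2).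
Proof. by apply: measurableX => //; exact: measurable_preimage_itv. Qed.

Let Ex (x1 x2 y1 y2 : R) : set (R * R) :=
  [set p | p.1 \in `[x1, x2]%R] `&` [set p | p.2 \in `]0, 1[%R] `&`
  ([set p | F (p.1, y1) < p.2] `&` [set p | p.2 <= F (p.1, y2)]).

Let mEx x1 x2 y1 y2 : measurable (Ex x1 x2 y1 y2).
Proof.
have m1 : measurable_fun [set: R * R] fst by exact: measurable_fst.
have m2 : measurable_fun [set: R * R] snd by exact: measurable_snd.
have mF y : measurable_fun [set: R * R] (fun p => F (p.1, y)).
  apply: (measurableT_comp (measurable_cdf hR)); apply: measurable_fun_pair => //.
apply: measurableI; apply: measurableI.
- by rewrite -[X in measurable X]setTI; exact: (m1 measurableT _ (measurable_itv `[x1, x2])).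
- by rewrite -[X in measurable X]setTI; exact: (m2 measurableT _ (measurable_itv `]0, 1[)).
- exact: measurable_lt_set.
- exact: measurable_le_set.
Qed.

Let ysection_Ex x1 x2 y1 y2 t : t \in `]0, 1[%R ->
  ysection (Ex x1 x2 y1 y2) t = crossing_x F t x1 x2 y1 y2.
Proof.
move=> t01; apply/seteqP; split => x; rewrite ysectionE /Ex /crossing_x/=.
  by move=> [[xI _] [-> ->]].
by move=> [xI /andP[Fx1 Fx2]].
Qed.

Lemma measurable_fun_crossing_x x1 x2 y1 y2 :
  measurable_fun (`]0, 1[%classic : set R)
    (fun t => lam (crossing_x F t x1 x2 y1 y2)).
Proof.
apply: (eq_measurable_fun (fun t => lam (ysection (Ex x1 x2 y1 y2) t))) => [t|].
  by rewrite inE/= => t01; rewrite ysection_Ex.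
by apply: measurable_funTS; apply: measurable_fun_ysection; exact: mEx.
Qed.

(** Tonelli: over a fixed [x] the levels crossed between [y1] and [y2] form an interval of length
    [F (x, y2) - F (x, y1)], the mass of the [s <= x] with [h s] in []y1, y2]]. *)
Lemma cell_triangle_le_crossing_x x1 x2 y1 y2 : 0 <= x1 -> x2 < 1 -> y1 <= y2 ->
  (lam2 (cell x1 x2 y1 y2 `&` triangle (fun x => x)) <=
   \int[lam]_(t in `]0%R, 1%R[) lam (crossing_x F t x1 x2 y1 y2))%E.
Proof.
move=> x10 x21 y12.
have mC : measurable (cell x1 x2 y1 y2 `&` triangle (fun x => x)).
  by apply: measurableI; [exact: measurable_cell|apply: measurable_triangle].
have -> : (\int[lam]_(t in `]0%R, 1%R[) lam (crossing_x F t x1 x2 y1 y2) =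
    lam2 (Ex x1 x2 y1 y2))%E.
  rewrite lam2_ysection; last exact: mEx.
  rewrite integral_mkcond; apply: eq_integral => t _.
  rewrite patchE; case: ifPn => [|/negP tn].
    by rewrite inE/= => t01; rewrite ysection_Ex.
  rewrite (_ : ysection _ _ = set0) ?measure0//.
  apply/seteqP; split => // s; rewrite ysectionE /Ex/= => -[[_ t01] _].
  by apply: tn; rewrite inE.
rewrite !lam2_xsection; apply: ge0_le_integral => //.
- by apply: measurable_fun_xsection.
- by apply: measurable_fun_xsection; exact: mEx.
move=> x _; have [xI|xI] := boolP (x1 <= x <= x2); last first.
  rewrite [xsection (cell _ _ _ _ `&` _) x](_ : _ = set0) ?measure0//.
  apply/seteqP; split => // s; rewrite xsectionE /cell/= in_itv/=.
  by move=> [[/andP[/ltW xx1 xx2] _] _]; move/negP: xI; rewrite xx1 xx2.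
have /andP[xx1 xx2] := xI; have x0 := le_trans x10 xx1.
have F1 := cdf_ge0 hR x y1; have F2 := cdf_le_fst hR y2 x0.
have F12 := cdf_le hR (lexx x) y12.
rewrite [xsection (Ex _ _ _ _) x](_ : _ = `]F (x, y1), F (x, y2)]%classic); last first.
  apply/seteqP; split => t; rewrite xsectionE /Ex/= !in_itv/=; first by move=> [_ [-> ->]].
  (* These levels stay below 1 because [F (x, y2) <= x <= x2 < 1]. *)
  by move=> /andP[Ft tF]; rewrite xI Ft tF (le_lt_trans F1)//=; split => //; split => //; lra.
rewrite lebesgue_itv// (cdf_incrr hR)//; apply: le_measure; rewrite ?inE.
- exact: measurable_xsection.
- by apply: measurableI => //; exact: measurable_preimage_itv.
- move=> s; rewrite xsectionE /cell /triangle/= /unit_interval !in_itv/=.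
  by move=> [[_ ->] [[/= _ +] ->]]; rewrite /unit_interval/= in_itv/= => /andP[-> _].
Qed.

Let Ey (x1 x2 y1 y2 : R) : set (R * R) :=
  [set p | p.1 \in `[y1, y2]%R] `&` [set p | p.2 \in `]0, 1[%R] `&`
  ([set p | F (x1, p.1) < p.2] `&` [set p | p.2 <= F (x2, p.1)]).

Let mEy x1 x2 y1 y2 : measurable (Ey x1 x2 y1 y2).
Proof.
have m1 : measurable_fun [set: R * R] fst by exact: measurable_fst.
have m2 : measurable_fun [set: R * R] snd by exact: measurable_snd.
have mF x : measurable_fun [set: R * R] (fun p => F (x, p.1)).
  apply: (measurableT_comp (measurable_cdf hR)); apply: measurable_fun_pair => //.
apply: measurableI; apply: measurableI.
- by rewrite -[X in measurable X]setTI; exact: (m1 measurableT _ (measurable_itv `[y1, y2])).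
- by rewrite -[X in measurable X]setTI; exact: (m2 measurableT _ (measurable_itv `]0, 1[)).
- exact: measurable_lt_set.
- exact: measurable_le_set.
Qed.

Let ysection_Ey x1 x2 y1 y2 t : t \in `]0, 1[%R ->
  ysection (Ey x1 x2 y1 y2) t = crossing_y F t x1 x2 y1 y2.
Proof.
move=> t01; apply/seteqP; split => x; rewrite ysectionE /Ey /crossing_y/=.
  by move=> [[xI _] [-> ->]].
by move=> [xI /andP[Fx1 Fx2]].
Qed.

Lemma measurable_fun_crossing_y x1 x2 y1 y2 :
  measurable_fun (`]0, 1[%classic : set R)
    (fun t => lam (crossing_y F t x1 x2 y1 y2)).
Proof.
apply: (eq_measurable_fun (fun t => lam (ysection (Ey x1 x2 y1 y2) t))) => [t|].
  by rewrite inE/= => t01; rewrite ysection_Ey.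
by apply: measurable_funTS; apply: measurable_fun_ysection; exact: mEy.
Qed.

(* The substitution [y = h s] turns the integral over ordinates into one over
   preimages. *)
Lemma cell_triangle_le_crossing_y x1 x2 y1 y2 :
  0 <= x1 -> x1 <= x2 -> 0 <= y1 -> y2 < 1 ->
  (lam2 (cell x1 x2 y1 y2 `&` triangle (fun x => (- h x)%R)) <=
   \int[lam]_(t in `]0%R, 1%R[) lam (crossing_y F t x1 x2 y1 y2))%E.
Proof.
move=> x10 x12 y10 y21.
have mC : measurable (cell x1 x2 y1 y2 `&` triangle (fun x => - h x)).
  apply: measurableI; first exact: measurable_cell.
  by apply: measurable_triangle; exact: measurableT_comp.
have -> : (\int[lam]_(t in `]0%R, 1%R[) lam (crossing_y F t x1 x2 y1 y2) =
    lam2 (Ey x1 x2 y1 y2))%E.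
  rewrite lam2_ysection; last exact: mEy.
  rewrite integral_mkcond; apply: eq_integral => t _.
  rewrite patchE; case: ifPn => [|/negP tn].
    by rewrite inE/= => t01; rewrite ysection_Ey.
  rewrite (_ : ysection _ _ = set0) ?measure0//.
  apply/seteqP; split => // s; rewrite ysectionE /Ey/= => -[[_ t01] _].
  by apply: tn; rewrite inE.
have msec := measurable_fun_xsection lam (mEy x1 x2 y1 y2).
have -> : lam2 (Ey x1 x2 y1 y2) =
    (\int[lam]_s lam (xsection (Ey x1 x2 y1 y2) (h s)))%E.
  pose T := measurableTypeR R.
  have mhT : @measurable_fun _ _ T T setT h by exact: mh.
  rewrite lam2_xsection; transitivity
      (\int[@pushforward _ _ T T R lam h]_y lam (xsection (Ey x1 x2 y1 y2) y))%E.
    apply: eq_measure_integral => S mS _.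
    by have [_ hp _ _ _] := hR; rewrite /= /pushforward hp.
  by rewrite (@ge0_integral_pushforward _ _ T T).
rewrite lam2_ysection//; apply: ge0_le_integral => //.
- by apply: measurable_fun_ysection.
- exact: (measurableT_comp msec mh).
move=> s _; have [sI|sI] := boolP (y1 <= h s <= y2); last first.
  rewrite [ysection (cell _ _ _ _ `&` _) s](_ : _ = set0) ?measure0//.
  apply/seteqP; split => // x; rewrite ysectionE /cell/= !in_itv/=.
  by move=> [[_ /andP[/ltW ss1 ss2]] _]; move/negP: sI; rewrite ss1 ss2.
have /andP[ss1 ss2] := sI; have s0 := le_trans y10 ss1.
have F1 := cdf_ge0 hR x1 (h s); have F2 := cdf_le_snd hR x2 s0.
have F12 := cdf_le hR x12 (lexx (h s)).
rewrite [xsection (Ey _ _ _ _) _](_ : _ = `]F (x1, h s), F (x2, h s)]%classic); last first.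
  apply/seteqP; split => t; rewrite xsectionE /Ey/= !in_itv/=; first by move=> [_ [-> ->]].
  by move=> /andP[Ft tF]; rewrite sI Ft tF (le_lt_trans F1)//=; split => //; split => //; lra.
rewrite lebesgue_itv// (cdf_incrl hR)//; apply: le_measure; rewrite ?inE.
- exact: measurable_ysection.
- by apply: measurableI => //; exact: measurable_preimage_itv.
- move=> x; rewrite ysectionE /cell /triangle/= /unit_interval !in_itv/= lerN2.
  by move=> [[-> _] [_ ->]].
Qed.

End integrated_length.

(** * Lower bound from a family of cells *)

Lemma measure_bigsetU_le d (T : measurableType d) (R : realType)
    (mu : {measure set T -> \bar R}) (I : finType) (E : I -> set T) (S : set T) :
  measurable S -> (forall k, measurable (E k)) ->
  (forall p, S p -> exists k, E k p) -> (mu S <= \sum_k mu (E k))%E.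
Proof.
move=> mS mE SE.
have mbig (r : seq I) : measurable (\big[setU/set0]_(k <- r) E k).
  by elim/big_ind: _ => // *; exact: measurableU.
apply: (@le_trans _ _ (mu (\big[setU/set0]_k E k))).
  apply: le_measure; rewrite ?inE// => p /SE[k Ekp].
  by rewrite (bigD1 k)//=; left.
elim: (index_enum I) => [|k r IH]; first by rewrite !big_nil measure0.
rewrite !big_cons; apply: (le_trans (measureU2 _ _ _)) => //.
by rewrite leeD2l.
Qed.

Section lower_bound.
Variables (R : realType) (h : R -> R).
Hypothesis hR : rearrangement h.

Local Notation lam := (@lebesgue_measure R).
Local Notation lam2 := (lam \x lam)%E.
Local Notation F := (completely_dependent_copula h).
Local Notation len t := (hausdorff1 (staircase F t `&` open_unit_square R)).

Let mh : measurable_fun setT h. Proof. by case: hR. Qed.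

Lemma lam2_fin_num (S : set (R * R)) : measurable S -> S `<=` unit_square R ->
  lam2 S \is a fin_num.
Proof.
move=> mS SI; rewrite ge0_fin_numE//; apply: (@le_lt_trans _ _ 1%E); last by rewrite ltry.
rewrite -lam2_unit_square; apply: le_measure; rewrite ?inE//.
exact: measurable_unit_square.
Qed.

Local Notation area S := (fine (lam2 S)).

Lemma area_le (S T : set (R * R)) : measurable S -> measurable T -> S `<=` T ->
  T `<=` unit_square R -> area S <= area T.
Proof.
move=> mS mT ST TI; apply: fine_le.
- exact: lam2_fin_num (subset_trans ST TI).
- exact: lam2_fin_num.
- by apply: le_measure; rewrite ?inE.
Qed.

Lemma area0 : area set0 = 0.
Proof. by rewrite measure0. Qed.

(* The weights [(1, 1) / sqrt 2], [(0, 1)] and [(1, 0)] are the components, up to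
   sign, of the unit tangent to a level curve where both partial derivatives are
   1, where only that in [x] is (on [A2 `\` A1]), and where only that in [y] is. *)
Lemma pure_cell_weights (C A1 A2 : set (R * R)) (G : set (R * R)) :
  measurable C -> measurable A1 -> measurable A2 -> measurable G ->
  A1 `<=` unit_square R -> A2 `<=` unit_square R ->
  (forall p q, C p -> G p -> C q -> G q -> A1 p -> A1 q) ->
  (forall p q, C p -> G p -> C q -> G q -> A2 p -> A2 q) ->
  exists ab : R * R, [/\ 0 <= ab.1, 0 <= ab.2, ab.1 ^+ 2 + ab.2 ^+ 2 <= 1 &
    Num.sqrt 2 * area (C `&` G `&` (A1 `&` A2)) +
      area (C `&` G `&` (A2 `\` A1)) + area (C `&` G `&` (A1 `\` A2))
    <= ab.1 * area (C `&` A1) + ab.2 * area (C `&` A2)].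
Proof.
move=> mC mA1 mA2 mG A1I A2I p1 p2.
set q := Num.sqrt 2.
have q2 : q ^+ 2 = 2 by rewrite sqr_sqrtr.
have q0 : 0 <= q by exact: sqrtr_ge0.
have CI1 : C `&` A1 `<=` unit_square R by move=> p [_ /A1I].
have CI2 : C `&` A2 `<=` unit_square R by move=> p [_ /A2I].
have mCA1 : measurable (C `&` A1) by exact: measurableI.
have mCA2 : measurable (C `&` A2) by exact: measurableI.
have mCG : measurable (C `&` G) by exact: measurableI.
(* The case distinction is on the type of gradient met in [C] within [G]; purity makes the other
   types empty there. *)
have [[p [[Cp Gp] [A1p A2p]]]|no11] :=
    pselect (exists p, (C `&` G `&` (A1 `&` A2)) p).
  exists (q / 2, q / 2); split => /=.
  - by rewrite divr_ge0.
  - by rewrite divr_ge0.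
  - by rewrite !expr_div_n q2; lra.
  have -> : C `&` G `&` (A2 `\` A1) = set0.
    by apply/seteqP; split => // x [[Cx Gx] [_]]; apply; exact: p1 A1p.
  have -> : C `&` G `&` (A1 `\` A2) = set0.
    by apply/seteqP; split => // x [[Cx Gx] [_]]; apply; exact: p2 A2p.
  rewrite !area0 !addr0.
  have m11 : measurable (C `&` G `&` (A1 `&` A2)).
    by apply: measurableI => //; exact: measurableI.
  have le1 : area (C `&` G `&` (A1 `&` A2)) <= area (C `&` A1).
    by apply: area_le => // x [[Cx _] [A1x _]].
  have le2 : area (C `&` G `&` (A1 `&` A2)) <= area (C `&` A2).
    by apply: area_le => // x [[Cx _] [_ A2x]].
  have := ler_wpM2l q0 le1; have := ler_wpM2l q0 le2.
  set u := area _; set v := area _; set w := area _ => H1 H2.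
  have -> : q / 2 * w + q / 2 * v = (q * v + q * w) / 2 by field.
  lra.
have -> : C `&` G `&` (A1 `&` A2) = set0.
  by apply/seteqP; split => // x Cx; apply: no11; exists x.
rewrite area0 mulr0 add0r.
have [[p [[Cp Gp] [A2p nA1p]]]|no10] := pselect (exists p, (C `&` G `&` (A2 `\` A1)) p).
  exists (0, 1); split => //=; first by rewrite expr0n/= add0r expr1n.
  have -> : C `&` G `&` (A1 `\` A2) = set0.
    apply/seteqP; split => // x [[Cx Gx] [A1x _]].
    by apply: nA1p; exact: p1 A1x.
  rewrite area0 addr0 mul0r mul1r add0r; apply: area_le => //.
    by apply: measurableI => //; exact: measurableD.
  by move=> x [[Cx _] [A2x _]].
have -> : C `&` G `&` (A2 `\` A1) = set0.
  by apply/seteqP; split => // x Cx; apply: no10; exists x.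
(* This choice also settles the case in which no type occurs. *)
exists (1, 0); split => //=; first by rewrite expr0n/= addr0 expr1n.
rewrite area0 add0r mul0r mul1r addr0; apply: area_le => //.
  by apply: measurableI => //; exact: measurableD.
by move=> x [[Cx _] [A2x _]].
Qed.

Local Notation A1 := (triangle (fun x : R => x)).
Local Notation A2 := (triangle (fun x : R => - h x)).

Let mA1 : measurable A1. Proof. exact: measurable_triangle. Qed.
Let mA2 : measurable A2.
Proof. by apply: measurable_triangle; exact: measurableT_comp. Qed.
Let A1I : A1 `<=` unit_square R. Proof. by move=> p []. Qed.
Let A2I : A2 `<=` unit_square R. Proof. by move=> p []. Qed.

Section family.
Variables (I : finType) (eta beta : R) (x1 x2 y1 y2 : I -> R) (G B : set (R * R)).
Let C k := cell h (x1 k) (x2 k) (y1 k) (y2 k).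
Hypothesis eta0 : 0 < eta.
Hypothesis xI : forall k, [/\ 0 < x1 k, x1 k <= x2 k & x2 k < 1].
Hypothesis yI : forall k, [/\ 0 < y1 k, y1 k <= y2 k & y2 k < 1].
Hypothesis sep : forall k k' p p', k != k' ->
  (`[x1 k, x2 k]%classic `*` `[y1 k, y2 k]%classic) p ->
  (`[x1 k', x2 k']%classic `*` `[y1 k', y2 k']%classic) p' ->
  eta < euclidean_dist p p'.
Hypothesis mG : measurable G.
Hypothesis mB : measurable B.
Hypothesis pure1 : forall k p q, C k p -> G p -> C k q -> G q -> A1 p -> A1 q.
Hypothesis pure2 : forall k p q, C k p -> G p -> C k q -> G q -> A2 p -> A2 q.
Hypothesis cover : forall p, unit_square R p -> B p \/ (G p /\ exists k, C k p).
Hypothesis Bbeta : (lam2 B <= beta%:E)%E.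

Let mC k : measurable (C k). Proof. exact: measurable_cell. Qed.

Lemma area_le_sum_cells (S : set (R * R)) : measurable S -> S `<=` unit_square R ->
  area S <= \sum_k area (C k `&` G `&` S) + beta.
Proof.
move=> mS SI.
have mE k : measurable (C k `&` G `&` S) by apply: measurableI => //; exact: measurableI.
rewrite -lee_fin fineK ?lam2_fin_num// EFinD -sumEFin.
have -> : (\sum_k (area (C k `&` G `&` S))%:E = \sum_k lam2 (C k `&` G `&` S))%E.
  by apply: eq_bigr => k _; rewrite fineK// lam2_fin_num// => p [_ /SI].
apply: (@le_trans _ _ (lam2 (S `\` B) + lam2 B)%E); last first.
  apply: leeD => //; apply: (measure_bigsetU_le lam2) => //; first exact: measurableD.
  by move=> p [Sp nB]; have [//|[Gp [k Ckp]]] := cover (SI _ Sp); exists k.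
apply: (@le_trans _ _ (lam2 ((S `\` B) `|` B))).
  apply: le_measure; rewrite ?inE//; first by apply: measurableU => //; exact: measurableD.
  by move=> p Sp; have [Bp|Bp] := pselect (B p); [right|left].
by apply: measureU2 => //; exact: measurableD.
Qed.

(** The uncovered area [beta] is lost once for each of the three types, with factors [sqrt 2], 1 and
    1, in total at most [4 * beta]. *)
Lemma target_le_integral_family :
  ((Num.sqrt 2 * area (A1 `&` A2) + area (A2 `\` A1) + area (A1 `\` A2))%:E <=
   \int[lam]_(t in `]0%R, 1%R[) len t + (4 * beta)%:E)%E.
Proof.
pose w k := sval (cid (pure_cell_weights (mC k) mA1 mA2 mG A1I A2I (@pure1 k) (@pure2 k))).
have w1 k : 0 <= (w k).1 by rewrite /w; case: cid => ? [].
have w2 k : 0 <= (w k).2 by rewrite /w; case: cid => ? [].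
have w12 k : (w k).1 ^+ 2 + (w k).2 ^+ 2 <= 1 by rewrite /w; case: cid => ? [].
have wle k : Num.sqrt 2 * area (C k `&` G `&` (A1 `&` A2)) +
      area (C k `&` G `&` (A2 `\` A1)) + area (C k `&` G `&` (A1 `\` A2))
    <= (w k).1 * area (C k `&` A1) + (w k).2 * area (C k `&` A2).
  by rewrite /w; case: cid => ? [].
have beta0 : 0 <= beta by rewrite -lee_fin; apply: le_trans Bbeta.
have q0 : 0 <= Num.sqrt 2 :> R by exact: sqrtr_ge0.
have q2 : Num.sqrt 2 <= 2 :> R.
  by rewrite -[leRHS]ger0_norm// -sqrtr_sqr ler_wsqrtr//; lra.
have box_sub k : `[x1 k, x2 k]%classic `*` `[y1 k, y2 k]%classic `<=` open_unit_square R.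
  move=> [x y] [/=]; rewrite !in_itv/= => /andP[xx1 xx2] /andP[yy1 yy2].
  have [x10 _ x21] := xI k; have [y10 _ y21] := yI k.
  split; rewrite /= in_itv/=.
    by rewrite (lt_le_trans x10 xx1) (le_lt_trans xx2 x21).
  by rewrite (lt_le_trans y10 yy1) (le_lt_trans yy2 y21).
have S11 := @area_le_sum_cells (A1 `&` A2) (measurableI _ _ mA1 mA2)
  (fun p Ap => A1I Ap.1).
have S10 := @area_le_sum_cells (A2 `\` A1) (measurableD mA2 mA1)
  (fun p Ap => A2I Ap.1).
have S01 := @area_le_sum_cells (A1 `\` A2) (measurableD mA1 mA2)
  (fun p Ap => A1I Ap.1).
have step1 : Num.sqrt 2 * area (A1 `&` A2) + area (A2 `\` A1) + area (A1 `\` A2) <=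
    \sum_k ((w k).1 * area (C k `&` A1) + (w k).2 * area (C k `&` A2)) + 4 * beta.
  have S11' := ler_wpM2l q0 S11; rewrite mulrDr mulr_sumr in S11'.
  have qb : Num.sqrt 2 * beta <= 2 * beta by exact: ler_wpM2r.
  have sums : \sum_k (Num.sqrt 2 * area (C k `&` G `&` (A1 `&` A2)) +
      area (C k `&` G `&` (A2 `\` A1)) + area (C k `&` G `&` (A1 `\` A2))) <=
    \sum_k ((w k).1 * area (C k `&` A1) + (w k).2 * area (C k `&` A2)).
    by apply: ler_sum => k _; exact: wle.
  apply: (le_trans (lerD (lerD S11' S10) S01)).
  apply: le_trans (lerD sums (lexx (4 * beta))); rewrite !big_split/=.
  have arith (x y z u v : R) : u <= 2 * v -> x + u + (y + v) + (z + v) <= x + y + z + 4 * v.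
    by lra.
  exact: arith.
apply: (@le_trans _ _ (\sum_k ((w k).1 * area (C k `&` A1) +
    (w k).2 * area (C k `&` A2)) + 4 * beta)%:E).
  by rewrite lee_fin.
rewrite EFinD leeD2r// -sumEFin.
pose cx k t := lam (crossing_x F t (x1 k) (x2 k) (y1 k) (y2 k)).
pose cy k t := lam (crossing_y F t (x1 k) (x2 k) (y1 k) (y2 k)).
apply: (@le_trans _ _ (\int[lam]_(t in `]0%R, 1%R[)
   (\sum_k ((w k).1%:E * cx k t + (w k).2%:E * cy k t)))%E); last first.
  apply: ge0_le_integral_nomeas => t t01.
    by apply: sume_ge0 => k _; apply: adde_ge0; apply: mule_ge0 => //; rewrite lee_fin.
  apply: (hausdorff1_staircase_ge (cdf_le hR) (cdf_lipschitz hR) (measurable_cdf hR)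
    t eta0 box_sub sep w1 w2 w12).
have mx k : measurable_fun (`]0, 1[%classic : set R) (cx k) by exact: measurable_fun_crossing_x.
have my k : measurable_fun (`]0, 1[%classic : set R) (cy k) by exact: measurable_fun_crossing_y.
have mwx k : measurable_fun (`]0, 1[%classic : set R) (fun t => (w k).1%:E * cx k t)%E.
  by apply: emeasurable_funM => //; exact: measurable_cst.
have mwy k : measurable_fun (`]0, 1[%classic : set R) (fun t => (w k).2%:E * cy k t)%E.
  by apply: emeasurable_funM => //; exact: measurable_cst.
have wx0 k t : (0 <= (w k).1%:E * cx k t)%E by apply: mule_ge0 => //; rewrite lee_fin.
have wy0 k t : (0 <= (w k).2%:E * cy k t)%E by apply: mule_ge0 => //; rewrite lee_fin.
rewrite ge0_integral_sum//; last 2 first.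
- by move=> k; exact: (emeasurable_funD (mwx k) (mwy k)).
- by move=> k t _; apply: adde_ge0.
apply: lee_sum => k _; rewrite ge0_integralD//; last 2 first.
- exact: mwx.
- exact: mwy.
rewrite !ge0_integralZl_EFin//; last 2 first.
- exact: my.
- exact: mx.
have [x10 x12 x21] := xI k; have [y10 y12 y21] := yI k.
rewrite EFinD !EFinM !fineK; last 2 first.
- by apply: lam2_fin_num; [exact: measurableI|move=> p [_ /A2I]].
- by apply: lam2_fin_num; [exact: measurableI|move=> p [_ /A1I]].
apply: leeD; apply: lee_wpmul2l; rewrite ?lee_fin//.
  by apply: cell_triangle_le_crossing_x => //; exact: ltW.
by apply: cell_triangle_le_crossing_y => //; exact: ltW.
Qed.

End family.

End lower_bound.

(** * The grid *)

Lemma le_euclidean_dist_fst (R : realType) (p q : R * R) :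
  `|p.1 - q.1| <= euclidean_dist p q.
Proof.
by rewrite -sqrtr_sqr /euclidean_dist ler_wsqrtr// lerDl sqr_ge0.
Qed.

Lemma le_euclidean_dist_snd (R : realType) (p q : R * R) :
  `|p.2 - q.2| <= euclidean_dist p q.
Proof.
by rewrite -sqrtr_sqr /euclidean_dist ler_wsqrtr// lerDr sqr_ge0.
Qed.

Section grid.
Variables (R : realType) (N : nat) (e : R).
Hypothesis N0 : (0 < N)%N.
Hypothesis e0 : 0 < e.
Hypothesis e4 : e < 4^-1.

Let n0 : 0 < N%:R :> R. Proof. by rewrite ltr0n. Qed.

(** Intervals of length [1 / N] are shortened by [e / N] at both ends: distinct ones are then more
    than [e / N] apart, and [e < 1 / 4] keeps them nonempty. *)
Definition grid_left (i : 'I_N) : R := (i%:R + e) / N%:R.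
Definition grid_right (i : 'I_N) : R := (i.+1%:R - e) / N%:R.

Definition grid_gap (i : nat) : set R :=
  `[i%:R / N%:R, (i%:R + e) / N%:R] `|` `[(i.+1%:R - e) / N%:R, i.+1%:R / N%:R].

Definition grid_gaps : set R := \big[setU/set0]_(i < N) grid_gap i.

Lemma grid_bounds i :
  [/\ 0 < grid_left i, grid_left i <= grid_right i & grid_right i < 1].
Proof.
have e0' := e0; have e4' := e4; have n0' := n0.
have i0 : 0 <= i%:R :> R by rewrite ler0n.
have iN : i.+1%:R <= N%:R :> R by rewrite ler_nat.
split; rewrite /grid_left /grid_right.
- by rewrite divr_gt0//; lra.
- by rewrite ler_pM2r ?invr_gt0// -natr1; lra.
- by rewrite ltr_pdivrMr// mul1r; lra.
Qed.

Lemma grid_width i : grid_right i - grid_left i < N%:R^-1.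
Proof.
have e0' := e0; have e4' := e4; have n0' := n0.
rewrite /grid_left /grid_right -mulrBl -[ltRHS]mul1r ltr_pM2r ?invr_gt0// -natr1.
lra.
Qed.

Lemma grid_separated i j x y : i != j ->
  grid_left i <= x <= grid_right i -> grid_left j <= y <= grid_right j ->
  e / N%:R < `|x - y|.
Proof.
wlog ij : i j x y / (i < j)%N => [H neq xi yj|_ /andP[_ xi] /andP[yj _]].
  have [ij|ji|ij] := ltngtP i j; first exact: (H i j).
    by rewrite distrC; apply: (H j i) => //; rewrite eq_sym.
  by move/eqP: neq; case; exact: val_inj.
have e0' := e0; have e4' := e4; have n0' := n0.
have ij1 : i.+1%:R <= j%:R :> R by rewrite ler_nat.
have gap : e / N%:R < grid_left j - grid_right i.
  by rewrite /grid_left /grid_right -mulrBl ltr_pM2r ?invr_gt0//; lra.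
by rewrite distrC; apply: (lt_le_trans _ (ler_norm _)); lra.
Qed.

Lemma measurable_grid_gap i : measurable (grid_gap i).
Proof. by apply: measurableU. Qed.

Lemma measurable_grid_gaps : measurable grid_gaps.
Proof. by apply: bigsetU_measurable => i _; exact: measurable_grid_gap. Qed.

(** The bound is independent of [N], which is chosen only after [e]. *)
Lemma lebesgue_grid_gaps : (lebesgue_measure grid_gaps <= (2 * e)%:E)%E.
Proof.
have e0' := e0; have e4' := e4; have n0' := n0.
apply: (@le_trans _ _ (\sum_(i < N) lebesgue_measure (grid_gap i))%E).
  apply: (measure_bigsetU_le (@lebesgue_measure R)).
  - exact: measurable_grid_gaps.
  - by move=> i; exact: measurable_grid_gap.
  - by move=> p; rewrite /grid_gaps -bigcup_mkord => -[i iN pi]; exists (Ordinal iN).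
apply: (@le_trans _ _ (\sum_(i < N) (2 * e / N%:R)%:E)%E).
  apply: lee_sum => i _; apply: (le_trans (measureU2 _ _ _)) => //.
  have i1 : i%:R / N%:R <= (i%:R + e) / N%:R by rewrite ler_pM2r ?invr_gt0//; lra.
  have i2 : (i.+1%:R - e) / N%:R <= i.+1%:R / N%:R by rewrite ler_pM2r ?invr_gt0//; lra.
  suff : (@lebesgue_measure R `[(i%:R / N%:R)%R, ((i%:R + e) / N%:R)%R]%classic +
      @lebesgue_measure R `[((i.+1%:R - e) / N%:R)%R, (i.+1%:R / N%:R)%R]%classic <=
      (2 * e / N%:R)%:E)%E by [].
  rewrite !lebesgue_itv// -EFinD lee_fin -!mulrBl -mulrDl ler_pM2r ?invr_gt0//; lra.
rewrite sumEFin sumr_const card_ord lee_fin -[_ *+ N]mulr_natr divfK//.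
by rewrite gt_eqF.
Qed.

Lemma grid_cover x : 0 <= x <= 1 ->
  grid_gaps x \/ exists i, grid_left i < x <= grid_right i.
Proof.
move=> /andP[x0 x1].
have [i iN /andP[ix xi]] : exists2 i, (i < N)%N & i%:R / N%:R <= x <= i.+1%:R / N%:R.
  have [x0'|x0'] := ltP 0 x; last first.
    have -> : x = 0 by lra.
    by exists 0%N => //; rewrite mul0r lexx divr_ge0.
  have [||i iN /andP[ix xi]] := @step_interval _ (fun i => i%:R / N%:R) N x.
  - by rewrite mul0r.
  - by rewrite divff// gt_eqF.
  by exists i => //; rewrite (ltW ix).
have gapx : grid_gap i x -> grid_gaps x.
  by move=> gx; rewrite /grid_gaps (bigD1 (Ordinal iN))//=; left.
have [xl|lx] := leP x ((i%:R + e) / N%:R).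
  by left; apply: gapx; left; rewrite /= in_itv/= ix.
have [xr|rx] := leP x ((i.+1%:R - e) / N%:R).
  by right; exists (Ordinal iN); rewrite /grid_left/= lx.
by left; apply: gapx; right; rewrite /= in_itv/= (ltW rx).
Qed.

End grid.

(** * Exceptional sets of small area *)

Section bad_sets.
Variable R : realType.

Local Notation lam := (@lebesgue_measure R).
Local Notation lam2 := (lam \x lam)%E.

Lemma lam2_le_xsection (S : set (R * R)) (c : R) :
  measurable S -> S `<=` unit_square R -> 0 <= c ->
  (forall x, (lam (xsection S x) <= c%:E)%E) -> (lam2 S <= c%:E)%E.
Proof.
move=> mS SI c0 Sc.
have -> : lam2 S = (\int[lam]_(x in unit_interval R) lam (xsection S x))%E.
  rewrite lam2_xsection [RHS]integral_mkcond; apply: eq_integral => x _.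
  rewrite patchE; case: ifPn => [//|/negP xn].
  rewrite (_ : xsection _ _ = set0) ?measure0//.
  apply/seteqP; split => // y; rewrite xsectionE/= => /SI[xI _].
  by apply: xn; rewrite inE.
apply: (@le_trans _ _ (\int[lam]_(x in unit_interval R) (cst c%:E x))%E).
  by apply: ge0_le_integral_nomeas.
rewrite integral_cst; last exact: measurable_unit_interval.
by rewrite [X in (_ * X)%E]lebesgue_unit_interval mule1.
Qed.

(** The neighbourhood of the ties of [f]: outside it the order of [f p.1] and [f p.2] survives when
    each moves by less than [c / 2]. *)
Definition near_level (f : R -> R) (c : R) : set (R * R) :=
  unit_square R `&` [set p | `|f p.1 - f p.2| <= c].

Lemma measurable_near_level f c : measurable_fun setT f ->
  measurable (near_level f c).
Proof.
move=> mf; apply: measurableI; first exact: measurable_unit_square.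
apply: measurable_le_set; last exact: measurable_cst.
apply: measurableT_comp; first exact: normr_measurable.
by apply: measurable_funB; apply: measurableT_comp.
Qed.

(** Each section lies in the preimage under [f] of an interval of length [2 * c]. *)
Lemma lam2_near_level f c : measurable_fun setT f -> 0 <= c ->
  (forall E : set R, measurable E -> lam (f @^-1` E) = lam E) ->
  (lam2 (near_level f c) <= (2 * c)%:E)%E.
Proof.
move=> mf c0 fp; apply: lam2_le_xsection.
- exact: measurable_near_level.
- by move=> p [].
- by rewrite mulr_ge0.
move=> x; have -> : (2 * c)%:E = lam (f @^-1` `[f x - c, f x + c]).
  by rewrite fp// lebesgue_itv; [congr (_%:E); ring|lra].
apply: le_measure; rewrite ?inE.
- by apply: measurable_xsection; exact: measurable_near_level.
- by rewrite -[X in measurable X]setTI; exact: mf.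
- move=> s; rewrite xsectionE /near_level/= in_itv/= => -[_].
  by rewrite distrC ler_distl.
Qed.

Lemma lam2_strip_fst (Z : set R) (c : R) : measurable Z ->
  (lam Z <= c%:E)%E -> (lam2 (Z `*` unit_interval R) <= c%:E)%E.
Proof.
move=> mZ Zc; have -> : lam2 (Z `*` unit_interval R) = (lam Z * lam (unit_interval R))%E.
  by apply: product_measure1E => //; exact: measurable_unit_interval.
by rewrite lebesgue_unit_interval mule1.
Qed.

Lemma lam2_strip_snd (Z : set R) (c : R) : measurable Z ->
  (lam Z <= c%:E)%E -> (lam2 (unit_interval R `*` Z) <= c%:E)%E.
Proof.
move=> mZ Zc; have -> : lam2 (unit_interval R `*` Z) = (lam (unit_interval R) * lam Z)%E.
  by apply: product_measure1E => //; exact: measurable_unit_interval.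
by rewrite lebesgue_unit_interval mul1e.
Qed.

End bad_sets.

(** * Sharp lower bound and value of the integrated length *)

Section target.
Variables (R : realType) (h : R -> R).
Hypothesis hR : rearrangement h.

Local Notation lam := (@lebesgue_measure R).
Local Notation lam2 := (lam \x lam)%E.
Local Notation F := (completely_dependent_copula h).
Local Notation len t := (hausdorff1 (staircase F t `&` open_unit_square R)).
Local Notation A1 := (triangle (fun x : R => x)).
Local Notation A2 := (triangle (fun x : R => - h x)).
Local Notation area S := (fine (lam2 S)).

Let mh : measurable_fun setT h. Proof. by case: hR. Qed.
Let hp (E : set R) : measurable E -> lam (h @^-1` E) = lam E.
Proof. by case: hR => _ + _ _ _; exact. Qed.
Let hin s : 0 <= s <= 1 -> 0 <= h s <= 1.
Proof. by case: hR => _ _ + _ _; exact. Qed.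
Let hI : injective h. Proof. by case: hR. Qed.

Lemma target_le_integral_eps (e : R) : 0 < e < 4^-1 ->
  ((Num.sqrt 2 * area (A1 `&` A2) + area (A2 `\` A1) + area (A1 `\` A2))%:E <=
   \int[lam]_(t in `]0%R, 1%R[) len t + (4 * (14 * e))%:E)%E.
Proof.
move=> /andP[e0 e4].
have mI := @measurable_unit_interval R.
have fI : (lam (unit_interval R) < +oo)%E by rewrite lebesgue_unit_interval ltry.
have [K [cK KI Ke cKh]] := measurable_almost_continuous mI fI e0 (measurable_funTS mh).
have mK := compact_measurable cK.
have cKid : {within K, continuous (@id R)}.
  by apply: continuous_subspaceT => x; exact: cvg_id.
(* [d1] is a modulus for [h] on [K] and [d2] one for its inverse. A grid finer than both controls
   [x] and [h s] directly, and then [h x] and [s] as well. *)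
have [d1 d10 H1] := injective_compact_modulus cK cKh cKid
  (fun x y _ _ (xy : x = y) => xy) e0.
have [d2 d20 H2] := injective_compact_modulus cK cKid cKh
  (fun x y _ _ (xy : h x = h y) => hI xy) e0.
pose d := Num.min e (Num.min d1 d2).
have d0 : 0 < d by rewrite !lt_min e0 d10.
have dd : [/\ d <= e, d <= d1 & d <= d2].
  by rewrite /d; split; rewrite !ge_min lexx ?orbT.
have [de dd1 dd2] := dd.
pose N := (Num.truncn d^-1).+1.
have N0 : (0 < N)%N by [].
have Nd : N%:R^-1 < d :> R by rewrite invf_plt ?posrE// ?ltr0n// truncnS_gt.
pose I := ('I_N * 'I_N)%type.
pose l := @grid_left R N e; pose r := @grid_right R N e.
pose G : set (R * R) := (K `*` K) `&` (~` near_level (fun x => x) (2 * e) `&`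
  ~` near_level h (2 * e)).
pose Z := grid_gaps N e.
have mZ : measurable Z by exact: measurable_grid_gaps.
have mhZ : measurable (h @^-1` Z) by rewrite -[X in measurable X]setTI; exact: mh.
have mIK : measurable (unit_interval R `\` K) by exact: measurableD.
pose B : set (R * R) :=
  (((unit_interval R `\` K) `*` unit_interval R) `|` (unit_interval R `*` (unit_interval R `\` K)))
  `|` (near_level (fun x => x) (2 * e) `|` near_level h (2 * e))
  `|` ((Z `*` unit_interval R) `|` (unit_interval R `*` (h @^-1` Z))).
have mN1 := @measurable_near_level R (fun x => x) (2 * e) (@measurable_id _ _ setT).
have mN2 := @measurable_near_level R h (2 * e) mh.
have e2 : 0 <= 2 * e by lra.
have mG : measurable G.
  by apply: measurableI; [exact: measurableX|apply: measurableI; exact: measurableC].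
have mB : measurable B.
  by apply: measurableU; [apply: measurableU|]; apply: measurableU => //; exact: measurableX.
have le_U (S T : set (R * R)) (a b c : R) : measurable S -> measurable T ->
    (lam2 S <= a%:E)%E -> (lam2 T <= b%:E)%E -> a + b = c -> (lam2 (S `|` T) <= c%:E)%E.
  move=> mS mT Sa Tb <-; apply: (@le_trans _ _ (lam2 S + lam2 T)%E).
    exact: measureU2.
  by rewrite EFinD; exact: leeD.
have IKe : (lam (unit_interval R `\` K) <= e%:E)%E by exact: ltW.
(* The complement of [K] costs [e] in each coordinate, each neighbourhood of ties [4 * e], and the
   grid gaps [2 * e] in each coordinate. *)
have Bb : (lam2 B <= (14 * e)%:E)%E.
  apply: (@le_U _ _ (10 * e) (4 * e)); last by ring.
  - by apply: measurableU; apply: measurableU => //; exact: measurableX.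
  - by apply: measurableU; exact: measurableX.
  - apply: (@le_U _ _ (2 * e) (8 * e)); last by ring.
    + by apply: measurableU; exact: measurableX.
    + exact: measurableU.
    + apply: (@le_U _ _ e e); last by ring.
      * exact: measurableX.
      * exact: measurableX.
      * exact: lam2_strip_fst.
      * exact: lam2_strip_snd.
    + apply: (@le_U _ _ (2 * (2 * e)) (2 * (2 * e))) => //; last by ring.
      * by apply: lam2_near_level.
      * by apply: lam2_near_level.
  - apply: (@le_U _ _ (2 * e) (2 * e)); last by ring.
    + exact: measurableX.
    + exact: measurableX.
    + by apply: lam2_strip_fst => //; exact: lebesgue_grid_gaps.
    + by apply: lam2_strip_snd => //; rewrite hp//; exact: lebesgue_grid_gaps.
have close (k : I) p q : cell h (l k.1) (r k.1) (l k.2) (r k.2) p -> G p ->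
    cell h (l k.1) (r k.1) (l k.2) (r k.2) q -> G q ->
    [/\ `|p.1 - q.1| < e, `|h p.2 - h q.2| < e, `|h p.1 - h q.1| < e & `|p.2 - q.2| < e].
  move=> [/=]; rewrite !in_itv/= => /andP[p1 p1'] /andP[p2 p2'] [[Kp1 Kp2] _].
  move=> [/=]; rewrite !in_itv/= => /andP[q1 q1'] /andP[q2 q2'] [[Kq1 Kq2] _].
  have w1 : r k.1 - l k.1 < N%:R^-1 by exact: grid_width.
  have w2 : r k.2 - l k.2 < N%:R^-1 by exact: grid_width.
  have D1 : `|p.1 - q.1| < d by rewrite ltr_distl; lra.
  have D2 : `|h p.2 - h q.2| < d by rewrite ltr_distl; lra.
  split.
  - exact: lt_le_trans D1 de.
  - exact: lt_le_trans D2 de.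
  - by apply: H1 => //; exact: lt_le_trans D1 dd1.
  - by apply: H2 => //; exact: lt_le_trans D2 dd2.
have sqK p : (K `*` K) p -> unit_square R p by move=> [/KI ? /KI ?].
apply: (@target_le_integral_family R h hR I (e / N%:R) (14 * e)
  (fun k => l k.1) (fun k => r k.1) (fun k => l k.2) (fun k => r k.2) G B) => //.
- by rewrite divr_gt0// ltr0n.
- by move=> k; exact: grid_bounds.
- by move=> k; exact: grid_bounds.
- move=> [i j] [i' j'] p p' neq [/=]; rewrite !in_itv/= => pi pj [/=] pi' pj'.
  have [ii|ii] := eqVneq i i'.
    have jj : j != j' by apply: contra neq => /eqP ->; rewrite ii.
    by apply: (lt_le_trans (grid_separated N0 e0 e4 jj pj pj')); exact: le_euclidean_dist_snd.
  by apply: (lt_le_trans (grid_separated N0 e0 e4 ii pi pi')); exact: le_euclidean_dist_fst.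
(* In [G] the two values differ by more than [2 * e]; from [p] to [q] each moves by less than [e],
   so their order persists. *)
- move=> k p q Cp Gp Cq Gq [_ /= p21].
  have [+ _ _ +] := close k p q Cp Gp Cq Gq; rewrite !ltr_distl.
  have [Kp [np _]] := Gp; have [Kq _] := Gq.
  move=> /andP[pq1 qp1] /andP[pq2 qp2]; split; first exact: sqK.
  have : ~ (`|p.1 - p.2| <= 2 * e) by move=> H; apply: np; split => //; exact: sqK.
  by move/negP; rewrite -ltNge ger0_norm /= ?subr_ge0//; lra.
- move=> k p q Cp Gp Cq Gq [_ /=]; rewrite lerN2 => p21.
  have [_ + + _] := close k p q Cp Gp Cq Gq; rewrite !ltr_distl.
  have [Kp [_ np]] := Gp; have [Kq _] := Gq.
  move=> /andP[pq2 qp2] /andP[pq1 qp1]; split; first exact: sqK.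
  have : ~ (`|h p.1 - h p.2| <= 2 * e) by move=> H; apply: np; split => //; exact: sqK.
  by move/negP; rewrite -ltNge /= lerN2 distrC ger0_norm ?subr_ge0//; lra.
- move=> [x s] [/= xI sI].
  have [Bxs|nB] := pselect (B (x, s)); [by left|right].
  have x01 : 0 <= x <= 1 by move: xI; rewrite /unit_interval/= in_itv.
  have s01 : 0 <= s <= 1 by move: sI; rewrite /unit_interval/= in_itv.
  split.
    split; last first.
      by split => nl; apply: nB; left; right; [left|right].
    split => /=; apply: contrapT => nK; apply: nB; left; left; [left|right]; by split.
  have [xZ|[i xi]] := grid_cover e N0 x01.
    by exfalso; apply: nB; right; left.
  have [sZ|[j sj]] := grid_cover e N0 (hin s01).
    by exfalso; apply: nB; right; right.
  by exists (i, j); split; rewrite /= in_itv/=.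
Qed.

Lemma integral_staircaseE :
  (\int[lam]_(t in `]0%R, 1%R[) len t =
    1 - (2 - Num.sqrt 2)%:E * lam2 (inversions h))%E.
Proof.
have mA1 : measurable A1 by exact: measurable_triangle.
have mA2 : measurable A2 by apply: measurable_triangle; exact: measurableT_comp.
have inj2 : injective (fun x => - h x) by move=> x y /oppr_inj/hI.
have mi := measurable_inversions hR.
have fi : lam2 (inversions h) \is a fin_num by apply: lam2_fin_num => // p [[]].
have T1 := @lam2_triangle R (fun x => x) (@measurable_id _ _ setT) (fun x y => id).
have T2 := @lam2_triangle R (fun x => - h x) (measurableT_comp (@oppr_measurable R setT) mh) inj2.
(* Each half of the square has area 1/2, so each of the two differences has area 1/2 minus that of
   the inversions. *)
have split2 (S T : set (R * R)) : measurable S -> measurable T -> S `<=` unit_square R ->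
    lam2 S = (2^-1)%:E -> area (S `\` T) = 2^-1 - area (S `&` T).
  move=> mS mT SI S2.
  have mST : measurable (S `&` T) by exact: measurableI.
  have mSD : measurable (S `\` T) by exact: measurableD.
  have : (lam2 (S `\` T) + lam2 (S `&` T) = (2^-1)%:E)%E.
    rewrite -S2 -measureU//; first by rewrite setUC setUIDK.
    by apply/seteqP; split => // p [[_ nT] [_ /nT]].
  have f1 : lam2 (S `\` T) \is a fin_num by apply: lam2_fin_num => // p [/SI].
  have f2 : lam2 (S `&` T) \is a fin_num by apply: lam2_fin_num => // p [/SI].
  rewrite -(fineK f1) -(fineK f2) -EFinD => /eqP; rewrite eqe => /eqP.
  by lra.
have A1I : A1 `<=` unit_square R by move=> p [].
have A2I : A2 `<=` unit_square R by move=> p [].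
have a10 := split2 A2 A1 mA2 mA1 A2I T2; rewrite setIC -/(inversions h) in a10.
have a01 := split2 A1 A2 mA1 mA2 A1I T1; rewrite -/(inversions h) in a01.
set q := Num.sqrt 2 in a10 a01 *.
set v := area (inversions h) in a10 a01.
have vE : lam2 (inversions h) = v%:E by rewrite fineK.
have upper := integral_staircase_le hR.
rewrite vE -EFinM in upper *; rewrite -EFinB.
apply/eqP; rewrite eq_le; apply/andP; split; first by rewrite EFinB leeBrDr.
apply/lee_addgt0Pr => e e0.
(* 56 is [4 * 14], the factor of the error term; 1/8 ensures [e' < 1 / 4]. *)
pose e' := Num.min (e / 56) (8^-1).
have e'0 : 0 < e' by rewrite lt_min divr_gt0//=.
have e'4 : e' < 4^-1 by rewrite gt_min; apply/orP; right; lra.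
have e'56 : 4 * (14 * e') <= e.
  have : e' <= e / 56 by rewrite ge_min lexx.
  lra.
have := target_le_integral_eps (introT andP (conj e'0 e'4)).
rewrite a10 a01 -/(inversions h) -/v -/q => H.
apply: (@le_trans _ _ (\int[lam]_(t in `]0%R, 1%R[) len t + (4 * (14 * e'))%:E)%E).
  apply: le_trans H; rewrite lee_fin; lra.
by rewrite leeD2l// lee_fin.
Qed.

End target.

(** * Extension of [h] to the line and conclusion *)

Theorem theorem3p1 (R : realType) (h : R -> R)
    (h_preserving : lambda_preserving h)
    (h_bijective : set_bij (unit_interval R) (unit_interval R) h) :
  length_measure (completely_dependent_copula h) =
  (1 - (2 - Num.sqrt 2) / 4 *
       (1 - kendall_tau (completely_dependent_copula h)))%:E.
Proof.
have [mh hI hp] := h_preserving; have [_ h_inj _] := h_bijective.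
pose g x := if x \in unit_interval R then h x else x.
have gin x : x \in unit_interval R -> g x = h x by rewrite /g => ->.
have gout x : x \notin unit_interval R -> g x = x by rewrite /g => /negbTE ->.
have mI := @measurable_unit_interval R.
(* [g] maps [[0, 1]] and its complement into themselves, so a preimage splits into a part governed
   by [h] and an unchanged part. *)
have gpre (E : set R) : g @^-1` E =
    (unit_interval R `&` h @^-1` (unit_interval R `&` E)) `|` (E `\` unit_interval R).
  apply/seteqP; split => x /=.
    have [xI|xI] := boolP (x \in unit_interval R).
      by rewrite gin// => Ehx; left; move/set_mem: xI => xI; split => //; split => //; exact: hI.
    by rewrite gout// => Ex; right; split => //; move/negP: xI; rewrite inE.
  move=> [[xI [_ Ehx]]|[Ex xI]]; first by rewrite gin// inE.
  by rewrite gout//; apply/negP; rewrite inE.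
have gR : rearrangement g.
  split.
  - move=> _ E mE; rewrite setTI gpre; apply: measurableU; last exact: measurableD.
    by apply: mh => //; exact: measurableI.
  - move=> E mE; have mIE : measurable (unit_interval R `&` E) by exact: measurableI.
    rewrite gpre measureU//=; last 3 first.
    + exact: mh.
    + exact: measurableD.
    + by apply/seteqP; split => // x [[xI _] [_ /(_ xI)]].
    rewrite hp//.
    rewrite -measureU//; last 2 first.
    + exact: measurableD.
    + by apply/seteqP; split => // x [[xI _] [_ /(_ xI)]].
    by rewrite setIC setUIDK.
  - move=> s s01; have sI : unit_interval R s by rewrite /unit_interval/= in_itv.
    by rewrite gin ?inE//; have := hI _ sI; rewrite /unit_interval/= in_itv.
  - by move=> s s01; rewrite gout//; apply/negP; rewrite inE /unit_interval/= in_itv.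
  - move=> x y; have [xI|xI] := boolP (x \in unit_interval R);
      have [yI|yI] := boolP (y \in unit_interval R).
    + by rewrite !gin//; exact: h_inj.
    + rewrite gin// gout// => hxy; move/negP: yI; rewrite -hxy inE => nI.
      by exfalso; apply: nI; apply: hI; rewrite inE in xI.
    + rewrite gout// gin// => hxy; move/negP: xI; rewrite hxy inE => nI.
      by exfalso; apply: nI; apply: hI; rewrite inE in yI.
    + by rewrite !gout.
have AF p : unit_square R p ->
    completely_dependent_copula h p = completely_dependent_copula g p.
  move=> [p1 p2]; rewrite /completely_dependent_copula; congr (fine (lebesgue_measure _)).
  have sI s : s \in `[0, p.1]%R -> s \in unit_interval R.
    move=> sp; apply/mem_set; move: p1 sp.
    rewrite /unit_interval/= !in_itv/= => /andP[_ p1] /andP[-> sp].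
    exact: le_trans p1.
  by apply/seteqP; split => s /= [sp]; rewrite ?gin ?sI// => hs; split => //; rewrite gin// sI.
have tauE := kendall_tauE gR AF.
have lE : length_measure (completely_dependent_copula h) =
    (1 - (2 - Num.sqrt 2)%:E * (@lebesgue_measure R \x @lebesgue_measure R) (inversions g))%E.
  rewrite -(integral_staircaseE gR) /length_measure; apply: eq_integral => t _.
  by rewrite /level_length (level_boundaryE (cdf_le gR) (cdf_lipschitz gR) t AF).
have fi : ((@lebesgue_measure R \x @lebesgue_measure R) (inversions g))%E \is a fin_num.
  by apply: lam2_fin_num => [|p [[]]//]; exact: measurable_inversions.
rewrite lE; move: tauE; rewrite -(fineK fi); set v := fine _.
rewrite -!EFinM -!EFinB => /eqP; rewrite eqe => /eqP ->; congr (_%:E).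
by field.
Qed.
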